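(* Let $f:\mathbb{R}^d\to\mathbb{R}$ be twice differentiable, $L$-smooth, $\mu$-strongly convex and $M$-strongly self-concordant, and let $\varkappa=L/\mu$. Let $1\le k<d$ and $\eta_0\ge1$, and run the randomized block BFGS method or the randomized block DFP method from $x_0\in\mathbb{R}^d$ and a symmetric positive definite $G_0\in\mathbb{R}^{d\times d}$ such that $$M\lambda(x_0)\le\frac{\ln 2}{4}\cdot\frac{d\varkappa-k}{\eta_0d^2\varkappa}\qquad\text{and}\qquad\nabla^2 f(x_0)\preceq G_0\preceq\eta_0\nabla^2 f(x_0).$$ Then for all $t\ge0$, $$\mathbb{E}\left[\frac{\lambda(x_{t+1})}{\lambda(x_t)}\right]\le2d\eta_0\left(1-\frac{k}{d\varkappa}\right)^t.$$
   Context: Notation: $\preceq$ is the Loewner order on symmetric matrices; $\|\cdot\|$ is the Euclidean norm; $\|v\|_z=(v^\top\nabla^2 f(z)v)^{1/2}$. Assumptions on $f$: $L$-smooth means $\|\nabla f(x)-\nabla f(y)\|\le L\|x-y\|$ for all $x,y$. $\mu$-strongly convex ($\mu>0$) means $f(\theta x+(1-\theta)y)\le\theta f(x)+(1-\theta)f(y)-\frac{\theta(1-\theta)\mu}{2}\|x-y\|^2$ for all $x,y$ and $\theta\in[0,1]$. $M$-strongly self-concordant ($M\ge0$) means $\nabla^2 f(y)-\nabla^2 f(x)\preceq M\|y-x\|_z\nabla^2 f(w)$ for all $x,y,z,w\in\mathbb{R}^d$. Local gradient norm: $\lambda(x)=\sqrt{\nabla f(x)^\top(\nabla^2 f(x))^{-1}\nabla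 f(x)}$. The ratio $\lambda(x_{t+1})/\lambda(x_t)$ is read as $0$ when $\lambda(x_t)=0$. Block updates: for symmetric positive definite $A\preceq G$ in $\mathbb{R}^{d\times d}$ and full rank $U\in\mathbb{R}^{d\times k}$, $k\le d$, $$\text{BlockBFGS}(G,A,U)=G-GU(U^\top GU)^{-1}U^\top G+AU(U^\top AU)^{-1}U^\top A,$$ $$\text{BlockDFP}(G,A,U)=AU(U^\top AU)^{-1}U^\top A+\big(I_d-AU(U^\top AU)^{-1}U^\top\big)G\big(I_d-U(U^\top AU)^{-1}U^\top A\big).$$ Randomized block BFGS/DFP method: given (deterministic) $x_0,G_0,k$, for $t=0,1,\dots$: $x_{t+1}=x_t-G_t^{-1}\nabla f(x_t)$; $r_t=\|x_{t+1}-x_t\|_{x_t}$; $\tilde G_t=(1+Mr_t)G_t$; draw $U_t\in\mathbb{R}^{d\times k}$ with i.i.d. $\mathcal{N}(0,1)$ entries, independent across iterations; set $G_{t+1}=\text{BlockBFGS}(\tilde G_t,\nabla^2 f(x_{t+1}),U_t)$ (BFGS variant, used at every iteration) or $G_{t+1}=\text{BlockDFP}(\tilde G_t,\nabla^2 f(x_{t+1}),U_t)$ (DFP variant, used at every iteration). The $U_t$ have full rank almost surely, so the method is defined almost surely. *)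

(* Defs.v *)
From HB Require Import structures.
From mathcomp Require Import all_boot all_order all_algebra.
From mathcomp Require Import all_classical all_reals all_analysis.

Set Implicit Arguments.
Unset Strict Implicit.
Unset Printing Implicit Defensive.

Import Order.TTheory GRing.Theory Num.Theory.
Import numFieldNormedType.Exports.

Local Open Scope classical_set_scope.
Local Open Scope ring_scope.

Definition dotv (R : realType) (d : nat) (u v : 'cV[R]_d) : R :=
  (u^T *m v) 0 0.

(* The norm `|v| that the library puts on 'cV[R]_d is the sup norm. *)
Definition enorm (R : realType) (d : nat) (v : 'cV[R]_d) : R :=
  Num.sqrt (dotv v v).

Definition posdef (R : realType) (d : nat) (A : 'M[R]_d) : Prop :=
  A^T = A /\ forall v : 'cV[R]_d, v != 0 -> 0 < dotv v (A *m v).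

(* Only meaningful between symmetric matrices, the only ones it is used on:
   it does not see the skew-symmetric part of B - A. *)
Definition loewner_le (R : realType) (d : nat) (A B : 'M[R]_d) : Prop :=
  forall v : 'cV[R]_d, dotv v (A *m v) <= dotv v (B *m v).

Definition gradient (R : realType) (d : nat) (f : 'cV[R]_d -> R)
    (x : 'cV[R]_d) : 'cV[R]_d :=
  \col_i 'D_(delta_mx i 0) f x.

Definition hessian (R : realType) (d : nat) (f : 'cV[R]_d -> R)
    (x : 'cV[R]_d) : 'M[R]_d :=
  \matrix_(i, j) 'D_(delta_mx j 0) (fun y => gradient f y i 0) x.

(* Frechet differentiability, of f and then of its gradient. *)
Definition twice_differentiable (R : realType) (d : nat)
    (f : 'cV[R]_d -> R) : Prop :=
  (forall x, differentiable f x) /\ (forall x, differentiable (gradient f) x).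

Definition smooth (R : realType) (d : nat) (L : R) (f : 'cV[R]_d -> R) : Prop :=
  forall x y, enorm (gradient f x - gradient f y) <= L * enorm (x - y).

Definition strongly_convex (R : realType) (d : nat) (mu : R)
    (f : 'cV[R]_d -> R) : Prop :=
  forall (x y : 'cV[R]_d) (theta : R), 0 <= theta <= 1 ->
    f (theta *: x + (1 - theta) *: y) <=
      theta * f x + (1 - theta) * f y
      - theta * (1 - theta) * mu / 2 * enorm (x - y) ^+ 2.

Definition hnorm (R : realType) (d : nat) (f : 'cV[R]_d -> R)
    (z v : 'cV[R]_d) : R :=
  Num.sqrt (dotv v (hessian f z *m v)).

Definition strongly_self_concordant (R : realType) (d : nat) (M : R)
    (f : 'cV[R]_d -> R) : Prop :=
  forall x y z w : 'cV[R]_d,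
    loewner_le (hessian f y - hessian f x)
               ((M * hnorm f z (y - x)) *: hessian f w).

Definition lambda (R : realType) (d : nat) (f : 'cV[R]_d -> R)
    (x : 'cV[R]_d) : R :=
  Num.sqrt (dotv (gradient f x) (invmx (hessian f x) *m gradient f x)).

(* invmx is the identity on singular matrices, so the two updates below have
   their intended meaning only when U has full rank. *)
Definition block_bfgs (R : realType) (d k : nat) (G A : 'M[R]_d)
    (U : 'M[R]_(d, k)) : 'M[R]_d :=
  G - G *m U *m invmx (U^T *m G *m U) *m U^T *m G
    + A *m U *m invmx (U^T *m A *m U) *m U^T *m A.

Definition block_dfp (R : realType) (d k : nat) (G A : 'M[R]_d)
    (U : 'M[R]_(d, k)) : 'M[R]_d :=
  A *m U *m invmx (U^T *m A *m U) *m U^T *m A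
  + (1%:M - A *m U *m invmx (U^T *m A *m U) *m U^T) *m G
    *m (1%:M - U *m invmx (U^T *m A *m U) *m U^T *m A).

Variant update_rule := BlockBFGS | BlockDFP.

Definition block_update (rule : update_rule) (R : realType) (d k : nat)
    (G A : 'M[R]_d) (U : 'M[R]_(d, k)) : 'M[R]_d :=
  match rule with
  | BlockBFGS => block_bfgs G A U
  | BlockDFP => block_dfp G A U
  end.

(* The pair (x_t, G_t) produced from (x0, G0) with the directions U_0, U_1, ... *)
Fixpoint iterate (rule : update_rule) (R : realType) (d k : nat)
    (f : 'cV[R]_d -> R) (M : R) (x0 : 'cV[R]_d) (G0 : 'M[R]_d)
    (U : nat -> 'M[R]_(d, k)) (t : nat) : 'cV[R]_d * 'M[R]_d :=
  match t with
  | 0%N => (x0, G0)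
  | s.+1 =>
      let: (x, G) := iterate rule f M x0 G0 U s in
      let x' := x - invmx G *m gradient f x in
      let r := hnorm f x (x' - x) in
      (x', block_update rule ((1 + M * r) *: G) (hessian f x') (U s))
  end.

(* As y / 0 = 0, the ratio is 0 when lambda (x_t) = 0. *)
Definition lambda_ratio (rule : update_rule) (R : realType) (d k : nat)
    (f : 'cV[R]_d -> R) (M : R) (x0 : 'cV[R]_d) (G0 : 'M[R]_d)
    (U : nat -> 'M[R]_(d, k)) (t : nat) : R :=
  lambda f (iterate rule f M x0 G0 U t.+1).1
  / lambda f (iterate rule f M x0 G0 U t).1.

Definition mutually_independent (R : realType) (disp : measure_display)
    (T : measurableType disp) (P : probability T R) (I : eqType)
    (X : I -> {RV P >-> R}) : Prop :=
  forall (s : seq I) (B : I -> set R),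
    uniq s -> (forall i, measurable (B i)) ->
    P (\bigcap_(i in [set` s]) (X i @^-1` B i))
      = (\prod_(i <- s) P (X i @^-1` B i))%E.

Definition standard_normal (R : realType) (disp : measure_display)
    (T : measurableType disp) (P : probability T R) (X : {RV P >-> R}) : Prop :=
  forall B : set R, measurable B ->
    distribution P X B = normal_prob (0 : R) (1 : R) B.

(* Entry (i, j) of U_t is U t i j. Joint independence of all the entries over
   all t, i, j is independence of the entries inside each U_t together with
   independence of the matrices U_0, U_1, ... *)
Definition gaussian_directions (R : realType) (disp : measure_display)
    (T : measurableType disp) (P : probability T R) (d k : nat)
    (U : nat -> 'I_d -> 'I_k -> {RV P >-> R}) : Prop :=
  (forall t i j, standard_normal (U t i j)) /\
  mutually_independent (fun a : nat * 'I_d * 'I_k => U a.1.1 a.1.2 a.2).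

Definition direction (R : realType) (disp : measure_display)
    (T : measurableType disp) (P : probability T R) (d k : nat)
    (U : nat -> 'I_d -> 'I_k -> {RV P >-> R}) (w : T) (t : nat) : 'M[R]_(d, k) :=
  \matrix_(i, j) U t i j w.

(* Main.v *)
(* With [A] the Hessian at [x_t], put [u = M lambda] and
   [sigma = tr (A^-1 (G - A))].  The mean value theorem along the step gives
   [lambda_(t+1) <= (1 + u/2) (sigma + u/2) lambda_t], and, when [G <= A / y],
   the contraction [lambda_(t+1) <= (1 + u/2) (1 - y + u/2) lambda_t]; the
   latter yields deterministic bounds [b_t] for [u] with a small sum.
   In the Loewner order [A <= BFGS <= DFP], and DFP lowers [sigma] by
   [tr (U (U^T A U)^-1 U^T (G - A))], which is at least [1/L] times the same
   expression with the Euclidean projector onto the range of [U].  Since the law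
   of [U] is invariant under signed row permutations, it is enough to average
   over this finite group, where a full rank projector averages to [k/d] times
   the identity.  Hence [sigma + 2 d u] contracts in expectation by
   [1 - k / (d kappa)] up to factors [1 + O(b_t d)] whose product is at most 2.
   The initial value is at most [d eta0]. *)

Require Import Defs.
From HB Require Import structures.
From mathcomp Require Import all_boot all_order all_algebra.
From mathcomp Require Import all_classical all_reals all_analysis.
From mathcomp Require Import measurable_realfun fingroup perm ring lra.
Import Order.TTheory GRing.Theory Num.Theory.
Import numFieldNormedType.Exports.
Local Open Scope classical_set_scope.
Local Open Scope ring_scope.

Set Implicit Arguments.
Unset Strict Implicit.
Unset Printing Implicit Defensive.

(** * Euclidean forms and the Loewner order *)

(** No conditional expectation is formed. All directions together are one random element of a
    coordinate space. A signed row permutation of the block of step [t] alone preserves its law and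
    leaves the state at time [t] untouched. So the expected potential at [t + 1] equals the
    expectation of its group average, and that average is bounded sample by sample by the potential
    at [t]. The term [2 d u] pays for the rescaling: passing to the next Hessian multiplies
    [tr (A^-1 G) = sigma + d] by up to [(1 + u)^2], which adds about [2 d u] to [sigma]. The
    condition number is the product of two losses, [1/L] in the comparison of projectors and [mu] in
    the comparison of [tr (G - A)] with [sigma]. The constant [ln 2 / 4] makes [b_0 eta0] at most
    [1/10], small enough for the deterministic recursion to sustain itself. The sum of the [b_t] is
    then [b_0 eta0] up to a factor close to 1, and the accumulated growth exponent stays below
    [ln 2]. *)

Lemma dotvC (R : realType) n (u v : 'cV[R]_n) : dotv u v = dotv v u.
Proof. by rewrite /dotv !mxE; apply: eq_bigr => i _; rewrite !mxE mulrC. Qed.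

Lemma dotvE (R : realType) n (u v : 'cV[R]_n) : dotv u v = \sum_i u i 0 * v i 0.
Proof. by rewrite /dotv mxE; apply: eq_bigr => i _; rewrite mxE. Qed.

Lemma dotvDl (R : realType) n (u v w : 'cV[R]_n) :
  dotv (u + v) w = dotv u w + dotv v w.
Proof. by rewrite /dotv linearD /= mulmxDl mxE. Qed.

Lemma dotvDr (R : realType) n (u v w : 'cV[R]_n) :
  dotv w (u + v) = dotv w u + dotv w v.
Proof. by rewrite /dotv mulmxDr mxE. Qed.

Lemma dotvZl (R : realType) n (a : R) (u v : 'cV[R]_n) :
  dotv (a *: u) v = a * dotv u v.
Proof. by rewrite /dotv linearZ /= -scalemxAl mxE. Qed.

Lemma dotvZr (R : realType) n (a : R) (u v : 'cV[R]_n) :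
  dotv u (a *: v) = a * dotv u v.
Proof. by rewrite dotvC dotvZl dotvC. Qed.

Lemma dotvNl (R : realType) n (u v : 'cV[R]_n) : dotv (- u) v = - dotv u v.
Proof. by rewrite -scaleN1r dotvZl mulN1r. Qed.

Lemma dotvNr (R : realType) n (u v : 'cV[R]_n) : dotv u (- v) = - dotv u v.
Proof. by rewrite -scaleN1r dotvZr mulN1r. Qed.

Lemma dotvBl (R : realType) n (u v w : 'cV[R]_n) :
  dotv (u - v) w = dotv u w - dotv v w.
Proof. by rewrite dotvDl dotvNl. Qed.

Lemma dotvBr (R : realType) n (u v w : 'cV[R]_n) :
  dotv w (u - v) = dotv w u - dotv w v.
Proof. by rewrite dotvDr dotvNr. Qed.

Lemma dotv0l (R : realType) n (u : 'cV[R]_n) : dotv 0 u = 0.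
Proof. by rewrite -(scale0r u) dotvZl mul0r. Qed.

Lemma dotv0r (R : realType) n (u : 'cV[R]_n) : dotv u 0 = 0.
Proof. by rewrite dotvC dotv0l. Qed.

Lemma dotv_trmx (R : realType) m n (A : 'M[R]_(m, n)) u v :
  dotv u (A *m v) = dotv (A^T *m u) v.
Proof. by rewrite /dotv trmx_mul trmxK mulmxA. Qed.

Lemma dotv_ge0 (R : realType) n (v : 'cV[R]_n) : 0 <= dotv v v.
Proof. by rewrite dotvE sumr_ge0 // => i _; rewrite -expr2 sqr_ge0. Qed.

Lemma dotv_eq0 (R : realType) n (v : 'cV[R]_n) : (dotv v v == 0) = (v == 0).
Proof.
apply/eqP/eqP => [|->]; last exact: dotv0l.
rewrite dotvE => /eqP; rewrite psumr_eq0; last first.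
  by move=> i _; rewrite -expr2 sqr_ge0.
move=> /allP h; apply/matrixP => i j; rewrite ord1 mxE.
by have := h i (mem_index_enum i); rewrite /= -expr2 sqrf_eq0 => /eqP.
Qed.

Lemma dotv_rank1 (R : realType) n (w v : 'cV[R]_n) :
  dotv v (w *m w^T *m v) = dotv w v ^+ 2.
Proof.
rewrite -mulmxA [w^T *m v]mx11_scalar mul_mx_scalar dotvZr (dotvC v).
by rewrite expr2.
Qed.

Definition dotvM := (dotvDl, dotvDr, dotvZl, dotvZr, dotvNl, dotvNr).

Definition psd (R : realType) n (A : 'M[R]_n) : Prop :=
  A^T = A /\ forall v : 'cV[R]_n, 0 <= dotv v (A *m v).

Lemma posdef_psd (R : realType) n (A : 'M[R]_n) : posdef A -> psd A.
Proof.
move=> [sA pA]; split => // v; have [->|/pA/ltW//] := eqVneq v 0.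
by rewrite dotv0l.
Qed.

Lemma dotv_sym (R : realType) n (A : 'M[R]_n) u v :
  A^T = A -> dotv u (A *m v) = dotv v (A *m u).
Proof. by move=> sA; rewrite dotv_trmx sA dotvC. Qed.

Lemma psd_loewner (R : realType) n (A B : 'M[R]_n) :
  A^T = A -> B^T = B -> loewner_le A B <-> psd (B - A).
Proof.
move=> sA sB; split => [h|[_ h] v].
  by split => [|v]; rewrite ?linearB /= ?sA ?sB // mulmxBl dotvBr subr_ge0.
by have := h v; rewrite mulmxBl dotvBr subr_ge0.
Qed.

Lemma psd_CS (R : realType) n (A : 'M[R]_n) u v : psd A ->
  dotv u (A *m v) ^+ 2 <= dotv u (A *m u) * dotv v (A *m v).
Proof.
move=> [sA pA].
have q t : 0 <= dotv u (A *m u) + 2 * t * dotv u (A *m v)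
                + t ^+ 2 * dotv v (A *m v).
  have := pA (u + t *: v).
  rewrite mulmxDr -scalemxAr !dotvM (dotv_sym v u sA).
  by congr (_ <= _); ring.
have := pA u; have := pA v.
move: q; set a := dotv u (A *m u); set b := dotv u _; set c := dotv v _.
move=> q c0 a0; have [c0'|cn0] := eqVneq c 0.
  have [b0|bn0] := eqVneq b 0; first by rewrite b0 c0' mulr0 expr0n.
  (* With [c = 0] the form is affine in [t], and this [t] gives it the value -1. *)
  have := q (- (a + 1) / (2 * b)); rewrite c0'.
  have -> : 2 * (- (a + 1) / (2 * b)) * b = - (a + 1) by field.
  by rewrite mulr0; lra.
have cp : 0 < c by rewrite lt_neqAle eq_sym cn0.
have := q (- b / c).
have -> : a + 2 * (- b / c) * b + (- b / c) ^+ 2 * c = (a * c - b ^+ 2) / c.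
  by field.
by rewrite pmulr_lge0 ?invr_gt0 // subr_ge0.
Qed.

Lemma dotv_delta (R : realType) n (A : 'M[R]_n) i j :
  dotv (delta_mx i 0) (A *m delta_mx j 0) = A i j.
Proof. by rewrite /dotv trmx_delta -colE -rowE !mxE. Qed.

Lemma psd_diag0 (R : realType) n (A : 'M[R]_n) :
  psd A -> (forall i, A i i = 0) -> A = 0.
Proof.
move=> pA A0; apply/matrixP => i j; rewrite mxE.
have := psd_CS (delta_mx i 0) (delta_mx j 0) pA.
rewrite !dotv_delta A0 mul0r => h.
by apply/eqP; rewrite -sqrf_eq0 eq_le h sqr_ge0.
Qed.

(* Peel off [(A e_i)(A e_i)^T / A_ii], which kills the i-th diagonal entry. *)
Lemma psd_sum_rank1 (R : realType) n (A : 'M[R]_n) :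
  psd A -> exists s : seq 'cV[R]_n, A = \sum_(w <- s) w *m w^T.
Proof.
move=> pA.
(* Induction on [m], from which index on the diagonal vanishes. Zeros already obtained survive a
   subtraction: it lowers the diagonal, which stays nonnegative. *)
have [m mn Am] : exists2 m, (m <= n)%N &
    forall i : 'I_n, (m <= i)%N -> A i i = 0.
  by exists n => // i; rewrite leqNgt ltn_ord.
elim: m A pA mn Am => [|m IH] A pA mn Am.
  exists [::]; rewrite big_nil; apply: psd_diag0 => // i; exact: Am.
pose i0 := Ordinal mn.
have [a0|an0] := eqVneq (A i0 i0) 0.
  apply: (IH A pA (ltnW mn)) => i; rewrite leq_eqVlt => /orP[/eqP mi|/Am//].
  by rewrite (_ : i = i0) //; apply: val_inj.
have [sA qA] := pA; pose a := A i0 i0; pose c := A *m delta_mx i0 0 : 'cV[R]_n.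
have ap : 0 < a by rewrite lt_neqAle eq_sym an0 /a -dotv_delta qA.
pose w := (Num.sqrt a)^-1 *: c.
have wE v : dotv v (w *m w^T *m v) = dotv v c ^+ 2 / a.
  rewrite dotv_rank1 /w dotvZl exprMn exprVn sqr_sqrtr ?ltW // mulrC.
  by rewrite (dotvC c).
have pA' : psd (A - w *m w^T).
  split=> [|v]; first by rewrite linearB /= sA trmx_mul trmxK.
  rewrite mulmxBl dotvBr wE subr_ge0 ler_pdivrMr //.
  by have := psd_CS v (delta_mx i0 0) pA; rewrite dotv_delta.
have [i mi|s sE] := IH _ pA' (ltnW mn).
  apply/eqP; rewrite eq_le -dotv_delta pA'.2 andbT mulmxBl dotvBr wE.
  move: mi; rewrite leq_eqVlt => /orP[/eqP mi|/Am Ai].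
    rewrite (_ : i = i0); last exact: val_inj.
    by rewrite dotv_delta -/a expr2 mulfK ?subrr ?gt_eqF.
  by rewrite dotv_delta Ai sub0r oppr_le0 divr_ge0 ?sqr_ge0 // ltW.
by exists (w :: s); rewrite big_cons -sE addrC subrK.
Qed.

(** Splitting [B] into rank one terms turns the trace into a sum of values [w^T A w]. *)
Lemma psd_mxtrace_mul (R : realType) n (A B : 'M[R]_n) :
  psd A -> psd B -> 0 <= \tr (A *m B).
Proof.
move=> [_ qA] /psd_sum_rank1[s ->].
rewrite mulmx_sumr raddf_sum sumr_ge0 //= => w _.
by rewrite mulmxA mxtrace_mulC mulmxA trace_mx11; have := qA w; rewrite /dotv mulmxA.
Qed.

Lemma mxtrace_mul_loewner (R : realType) n (A B C : 'M[R]_n) :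
  psd C -> A^T = A -> B^T = B -> loewner_le A B ->
  \tr (A *m C) <= \tr (B *m C).
Proof.
move=> pC sA sB /(psd_loewner sA sB) pBA.
by rewrite -subr_ge0 -linearB -mulmxBl psd_mxtrace_mul.
Qed.

Lemma posdef_unit (R : realType) n (A : 'M[R]_n) : posdef A -> A \in unitmx.
Proof.
move=> [sA pA]; rewrite -row_free_unit -kermx_eq0; apply/rowV0P => v /sub_kermxP vA.
apply/eqP; rewrite -(inj_eq trmx_inj) trmx0; apply/negPn/negP => /pA.
by rewrite -sA -trmx_mul vA trmx0 dotv0r ltxx.
Qed.

Lemma posdef_inv (R : realType) n (A : 'M[R]_n) : posdef A -> posdef (invmx A).
Proof.
move=> pA; have [sA qA] := pA; have uA := posdef_unit pA.
split=> [|v v0]; first by rewrite trmx_inv sA.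
have : invmx A *m v != 0.
  by apply: contra v0 => /eqP h; rewrite -(mulKVmx uA v) h mulmx0.
by move=> /qA; rewrite mulKVmx // dotvC.
Qed.

Lemma posdef_loewner (R : realType) n (A B : 'M[R]_n) :
  posdef A -> B^T = B -> loewner_le A B -> posdef B.
Proof. by move=> [sA qA] sB AB; split=> // v /qA /lt_le_trans; apply. Qed.

(** With [x = B^-1 v] and [y = A^-1 v], Cauchy-Schwarz for [A] gives [(v^T x)^2 = (y^T A x)^2 <=
    (v^T y) (x^T A x) <= (v^T y) (v^T x)]; it remains to divide by [v^T x]. *)
Lemma loewner_inv (R : realType) n (A B : 'M[R]_n) :
  posdef A -> posdef B -> loewner_le A B -> loewner_le (invmx B) (invmx A).
Proof.
move=> pA pB AB v; have uA := posdef_unit pA; have uB := posdef_unit pB.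
have := posdef_psd (posdef_inv pB) => -[_ /(_ v) q0].
set x := invmx B *m v in q0 *; set y := invmx A *m v.
have Bx : B *m x = v by rewrite mulKVmx.
have Ay : A *m y = v by rewrite mulKVmx.
have h1 := AB x; have h2 := psd_CS y x (posdef_psd pA).
rewrite (dotv_sym _ _ pA.1) Ay expr2 !(dotvC _ v) in h2.
rewrite Bx (dotvC _ v) in h1.
have yp : 0 <= dotv v y by exact: (posdef_psd (posdef_inv pA)).2.
move: q0; rewrite le_eqVlt => /orP[/eqP <- //|q0].
by rewrite -(ler_pM2r q0); apply: (le_trans h2); rewrite ler_wpM2l.
Qed.

Lemma posdef_scale (R : realType) n (a : R) (A : 'M[R]_n) :
  0 < a -> posdef A -> posdef (a *: A).
Proof.
move=> a0 [sA qA]; split=> [|v v0]; first by rewrite linearZ /= sA.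
by rewrite -scalemxAl dotvZr mulr_gt0 // qA.
Qed.

Lemma posdef1 (R : realType) n : posdef (1%:M : 'M[R]_n).
Proof.
split=> [|v v0]; first exact: trmx1.
by rewrite mul1mx lt_neqAle eq_sym dotv_eq0 v0 dotv_ge0.
Qed.

(* [v v^T <= A^-1] as soon as [v^T A v <= 1]. *)
Lemma loewner_mxtrace (R : realType) n (A B : 'M[R]_n) v :
  posdef A -> psd B ->
  dotv v (B *m v) <= \tr (invmx A *m B) * dotv v (A *m v).
Proof.
move=> pA pB; have uA := posdef_unit pA; have pA' := posdef_psd (posdef_inv pA).
have := (posdef_psd pA).2 v; rewrite le_eqVlt => /orP[/eqP c0|c0].
  have -> : v = 0; last by rewrite !dotv0l mulr0.
  by apply/eqP/negPn/negP => /pA.2; rewrite -c0 ltxx.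
set c := dotv v (A *m v) in c0 *.
have pC : psd (invmx A - c^-1 *: (v *m v^T)).
  split=> [|x]; first by rewrite linearB linearZ /= trmx_mul trmxK pA'.1.
  rewrite mulmxBl dotvBr -scalemxAl dotvZr subr_ge0 mulrC ler_pdivrMr //.
  rewrite dotv_rank1 (dotvC v).
  have := psd_CS x (A *m v) pA'; rewrite mulKmx // => h.
  by apply: le_trans h _; rewrite (dotvC (A *m v)).
have := psd_mxtrace_mul pC pB.
rewrite mulmxBl linearB /= -scalemxAl linearZ /= subr_ge0.
have -> : \tr (v *m v^T *m B) = dotv v (B *m v).
  by rewrite -mulmxA mxtrace_mulC trace_mx11 /dotv mulmxA.
by rewrite mulrC ler_pdivrMr.
Qed.

(** * Block BFGS and DFP updates *)

(** Stated through the Gram matrix because the Gram matrix is unchanged when [U] is multiplied on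
    the left by an orthogonal matrix. *)
Definition full_col_rank (R : realType) d k (U : 'M[R]_(d, k)) : bool :=
  U^T *m U \in unitmx.

Lemma posdef_restrict (R : realType) d k (A : 'M[R]_d) (U : 'M[R]_(d, k)) :
  posdef A -> full_col_rank U -> posdef (U^T *m A *m U).
Proof.
move=> [sA qA] fU; split=> [|v v0]; first by rewrite !trmx_mul trmxK sA mulmxA.
rewrite -!mulmxA dotv_trmx trmxK; apply: qA.
by apply: contra v0 => /eqP h; rewrite -(mulKmx fU v) -mulmxA h !mulmx0.
Qed.

(* [range_inv A U *m A] is the A-orthogonal projector onto the range of U. *)
HB.lock Definition range_inv (R : realType) d k (A : 'M[R]_d)
    (U : 'M[R]_(d, k)) : 'M[R]_d :=
  U *m invmx (U^T *m A *m U) *m U^T.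

Definition range_invE := range_inv.unlock.

Lemma range_inv_trmx (R : realType) d k (A : 'M[R]_d) (U : 'M[R]_(d, k)) :
  A^T = A -> (range_inv A U)^T = range_inv A U.
Proof.
by move=> sA; rewrite range_invE !trmx_mul trmxK trmx_inv !trmx_mul trmxK sA !mulmxA.
Qed.

Lemma range_invK (R : realType) d k (A : 'M[R]_d) (U : 'M[R]_(d, k)) :
  posdef A -> full_col_rank U -> U^T *m A *m range_inv A U = U^T.
Proof.
move=> pA fU; have := posdef_unit (posdef_restrict pA fU).
by rewrite range_invE !mulmxA => uK; rewrite mulmxV // mul1mx.
Qed.

Lemma range_inv_idem (R : realType) d k (A : 'M[R]_d) (U : 'M[R]_(d, k)) :
  posdef A -> full_col_rank U ->
  range_inv A U *m A *m range_inv A U = range_inv A U.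
Proof.
move=> pA fU; rewrite {1}range_invE.
rewrite -[_ *m A *m _]mulmxA -[_ *m U^T *m _]mulmxA [U^T *m (A *m _)]mulmxA.
by rewrite range_invK // range_invE.
Qed.

(** [v - q] is A-orthogonal to the range of [U], and [q - U c] lies in that range. The first term on
    the right is therefore the minimum over [c], attained when [U c = q]. *)
Lemma range_inv_pythagoras (R : realType) d k (A : 'M[R]_d) (U : 'M[R]_(d, k)) v c :
  posdef A -> full_col_rank U ->
  let q := range_inv A U *m A *m v in
  dotv (v - U *m c) (A *m (v - U *m c)) =
  dotv v ((A - A *m range_inv A U *m A) *m v) + dotv (q - U *m c) (A *m (q - U *m c)).
Proof.
move=> pA fU q; have sA := pA.1.
have o : U^T *m (A *m (v - q)) = 0.
  by rewrite !mulmxBr /q !mulmxA range_invK // subrr.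
have -> : v - U *m c = (v - q) + (q - U *m c) by rewrite addrA subrK.
have [c' qc] : exists c', q - U *m c = U *m c'.
  exists (invmx (U^T *m A *m U) *m U^T *m A *m v - c).
  by rewrite mulmxBr /q range_invE !mulmxA.
have z e : dotv (U *m e) (A *m (v - q)) = 0.
  by rewrite dotvC dotv_trmx o dotv0l.
have qE : q = U *m (invmx (U^T *m A *m U) *m U^T *m A *m v).
  by rewrite /q range_invE !mulmxA.
have sq w e : dotv (w + e) (A *m (w + e)) =
    dotv w (A *m w) + dotv e (A *m e) + 2 * dotv e (A *m w).
  by rewrite mulmxDr !dotvM (dotv_sym w e sA); ring.
rewrite sq {3}qc z mulr0 addr0.
have zq : dotv q (A *m (v - q)) = 0 by rewrite {1}qE z.
congr (_ + _); rewrite dotvBl zq subr0 /q mulmxBl mulmxBr.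
by rewrite !mulmxA.
Qed.

Lemma range_inv_quad (R : realType) d k (A : 'M[R]_d) (U : 'M[R]_(d, k)) v :
  posdef A -> full_col_rank U ->
  let p := range_inv A U *m A *m v in
  dotv p (A *m p) = dotv v (A *m range_inv A U *m A *m v).
Proof.
move=> pA fU p; rewrite {1}/p dotvC dotv_trmx dotvC.
rewrite trmx_mul range_inv_trmx ?pA.1 // /p !mulmxA.
have -> : A *m range_inv A U *m A *m range_inv A U *m A *m v =
  A *m (range_inv A U *m A *m range_inv A U) *m A *m v by rewrite !mulmxA.
by rewrite range_inv_idem.
Qed.

Lemma block_dfpE (R : realType) d k (G A : 'M[R]_d) (U : 'M[R]_(d, k)) :
  block_dfp G A U = A *m range_inv A U *m A +
    (1%:M - A *m range_inv A U) *m G *m (1%:M - range_inv A U *m A).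
Proof. by rewrite /block_dfp range_invE !mulmxA. Qed.

Lemma block_bfgsE (R : realType) d k (G A : 'M[R]_d) (U : 'M[R]_(d, k)) :
  block_bfgs G A U = G - G *m range_inv G U *m G + A *m range_inv A U *m A.
Proof. by rewrite /block_bfgs range_invE !mulmxA. Qed.

Lemma block_dfp_quad (R : realType) d k (G A : 'M[R]_d) (U : 'M[R]_(d, k)) v :
  A^T = A -> let w := v - range_inv A U *m A *m v in
  dotv v (block_dfp G A U *m v) = dotv v (A *m range_inv A U *m A *m v)
    + dotv w (G *m w).
Proof.
move=> sA w; rewrite block_dfpE mulmxDl dotvDr; congr (_ + _).
rewrite -2!mulmxA dotv_trmx linearB /= trmx1 trmx_mul sA range_inv_trmx //.
by rewrite -[G *m _ *m v]mulmxA mulmxBl mul1mx.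
Qed.

(** Lets [A] be written as its own update: comparisons of an update with [A] reduce to monotonicity
    in [G], and the error [G - A] transforms linearly. *)
Lemma block_dfp_id (R : realType) d k (A : 'M[R]_d) (U : 'M[R]_(d, k)) :
  posdef A -> full_col_rank U -> block_dfp A A U = A.
Proof.
move=> pA fU; rewrite block_dfpE mulmxBl mul1mx.
set Q := range_inv A U.
have -> : (A - A *m Q *m A) *m (1%:M - Q *m A) =
    A - A *m Q *m A - A *m Q *m A + A *m (Q *m A *m Q) *m A.
  by rewrite mulmxBr mulmx1 mulmxBl !mulmxA opprB addrA addrAC.
by rewrite range_inv_idem // subrK addrC subrK.
Qed.

Lemma loewner_trans (R : realType) d (A B C : 'M[R]_d) :
  loewner_le A B -> loewner_le B C -> loewner_le A C.
Proof. by move=> h1 h2 v; exact: le_trans (h1 v) (h2 v). Qed.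

Lemma block_dfp_mono (R : realType) d k (G G' A : 'M[R]_d) (U : 'M[R]_(d, k)) :
  A^T = A -> loewner_le G G' -> loewner_le (block_dfp G A U) (block_dfp G' A U).
Proof. by move=> sA GG' v; rewrite !block_dfp_quad // lerD2l. Qed.

(* The first part of the BFGS form at [v] is the minimum over [c] of the G-norm
   of [v - U c]; the one of the DFP form is the value at one such [c]. *)
Lemma block_bfgs_le_dfp (R : realType) d k (G A : 'M[R]_d) (U : 'M[R]_(d, k)) :
  posdef A -> posdef G -> full_col_rank U ->
  loewner_le (block_bfgs G A U) (block_dfp G A U).
Proof.
move=> pA pG fU v; rewrite block_dfp_quad ?pA.1 // block_bfgsE mulmxDl dotvDr.
rewrite addrC lerD2l.
have -> : range_inv A U *m A *m v = U *m (invmx (U^T *m A *m U) *m U^T *m A *m v).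
  by rewrite range_invE !mulmxA.
rewrite range_inv_pythagoras // lerDl; exact: (posdef_psd pG).2.
Qed.

(** At the [c] that minimises the G-norm of [v - U c], the A-norm is no larger than the G-norm and
    no smaller than its own minimum; the part along the range of [U] is the same on both sides. *)
Lemma block_bfgs_ge (R : realType) d k (G A : 'M[R]_d) (U : 'M[R]_(d, k)) :
  posdef A -> posdef G -> full_col_rank U -> loewner_le A G ->
  loewner_le A (block_bfgs G A U).
Proof.
move=> pA pG fU AG v; rewrite block_bfgsE mulmxDl dotvDr.
pose c := invmx (U^T *m G *m U) *m U^T *m G *m v.
have qE : range_inv G U *m G *m v = U *m c by rewrite /c range_invE !mulmxA.
have := range_inv_pythagoras v c pG fU.
rewrite /= qE subrr mulmx0 dotv0l addr0 => <-.
have := AG (v - U *m c); rewrite (range_inv_pythagoras v c pA fU) => h.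
have := (posdef_psd pA).2 (range_inv A U *m A *m v - U *m c).
have -> : dotv v (A *m v) = dotv v ((A - A *m range_inv A U *m A) *m v) +
   dotv v (A *m range_inv A U *m A *m v) by rewrite mulmxBl dotvBr subrK.
by move: h; lra.
Qed.

(** The update of [eta *: A] differs from [eta *: A] only along the range of [U], where it has the
    factor 1 instead of [eta]. *)
Lemma block_dfp_scale_le (R : realType) d k (eta : R) (G A : 'M[R]_d) (U : 'M[R]_(d, k)) :
  posdef A -> full_col_rank U -> 1 <= eta -> loewner_le G (eta *: A) ->
  loewner_le (block_dfp G A U) (eta *: A).
Proof.
move=> pA fU eta1 GA; apply: (loewner_trans (block_dfp_mono U pA.1 GA)) => v.
rewrite -{3}(block_dfp_id pA fU) -scalemxAl dotvZr !block_dfp_quad ?pA.1 //.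
rewrite -scalemxAl dotvZr mulrDr lerD2r -range_inv_quad //.
by rewrite ler_peMl // (posdef_psd pA).2.
Qed.

(** With [Q = range_inv A U], the new error is [(1 - A Q) (G - A) (1 - Q A)]. Cycling the trace
    leaves the weight [(1 - Q A) A^-1 (1 - A Q)], which equals [A^-1 - Q] since [Q A Q = Q]. *)
Lemma mxtrace_block_dfp (R : realType) d k (G A : 'M[R]_d) (U : 'M[R]_(d, k)) :
  posdef A -> full_col_rank U ->
  \tr (invmx A *m (block_dfp G A U - A)) =
  \tr (invmx A *m (G - A)) - \tr (range_inv A U *m (G - A)).
Proof.
move=> pA fU; have uA := posdef_unit pA; set Q := range_inv A U.
have -> : block_dfp G A U - A = (1%:M - A *m Q) *m (G - A) *m (1%:M - Q *m A).
  rewrite -[X in _ - X](block_dfp_id pA fU) !block_dfpE -/Q.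
  by rewrite opprD addrACA subrr add0r -mulmxBl -mulmxBr.
rewrite mulmxA mxtrace_mulC !mulmxA -linearB /= -mulmxBl; congr (\tr (_ *m _)).
rewrite mulmxBl mul1mx -[Q *m A *m _]mulmxA mulmxV // mulmx1.
rewrite mulmxBr mulmx1 mulmxBl !mulmxA mulVmx // mul1mx range_inv_idem //.
by rewrite subrr subr0.
Qed.

Lemma block_update_trmx rule (R : realType) d k (G A : 'M[R]_d) (U : 'M[R]_(d, k)) :
  A^T = A -> G^T = G -> (block_update rule G A U)^T = block_update rule G A U.
Proof.
move=> sA sG; case: rule; rewrite /= ?block_dfpE ?block_bfgsE.
  by rewrite linearD linearB /= !trmx_mul !range_inv_trmx // sA sG !mulmxA.
rewrite linearD /= !trmx_mul !linearB /= !trmx_mul !range_inv_trmx // sA sG !trmx1.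
by rewrite !mulmxA.
Qed.

Lemma block_update_le_dfp rule (R : realType) d k (G A : 'M[R]_d) (U : 'M[R]_(d, k)) :
  posdef A -> posdef G -> full_col_rank U ->
  loewner_le (block_update rule G A U) (block_dfp G A U).
Proof. by move=> pA pG fU; case: rule => [|//]; apply: block_bfgs_le_dfp. Qed.

Lemma block_update_ge rule (R : realType) d k (G A : 'M[R]_d) (U : 'M[R]_(d, k)) :
  posdef A -> posdef G -> full_col_rank U -> loewner_le A G ->
  loewner_le A (block_update rule G A U).
Proof.
move=> pA pG fU AG; case: rule; first exact: block_bfgs_ge.
by have := block_dfp_mono U pA.1 AG; rewrite block_dfp_id.
Qed.

Lemma block_update_mxtrace rule (R : realType) d k (G A : 'M[R]_d) (U : 'M[R]_(d, k)) :
  posdef A -> posdef G -> full_col_rank U ->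
  \tr (invmx A *m (block_update rule G A U - A)) <=
  \tr (invmx A *m (G - A)) - \tr (range_inv A U *m (G - A)).
Proof.
move=> pA pG fU; rewrite -mxtrace_block_dfp // !mulmxBr !linearB /= lerD2r.
rewrite ![\tr (invmx A *m _)]mxtrace_mulC.
apply: mxtrace_mul_loewner; first exact: posdef_psd (posdef_inv pA).
- by apply: block_update_trmx; rewrite ?pA.1 ?pG.1.
- by have := block_update_trmx BlockDFP U pA.1 pG.1.
- exact: block_update_le_dfp.
Qed.

(** [U^T A U <= L U^T U], and inversion reverses the order. *)
Lemma range_inv_scale_ge (R : realType) d k (L : R) (A : 'M[R]_d) (U : 'M[R]_(d, k)) :
  0 < L -> posdef A -> full_col_rank U -> loewner_le A (L%:M) ->
  loewner_le (L^-1 *: range_inv 1%:M U) (range_inv A U).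
Proof.
move=> L0 pA fU AL v.
have p1 := posdef_restrict (@posdef1 R d) fU.
have pL := posdef_scale L0 p1.
have e (K : 'M[R]_k) : dotv v (U *m invmx K *m U^T *m v) = dotv (U^T *m v) (invmx K *m (U^T *m v)).
  by rewrite -!mulmxA dotv_trmx.
rewrite -scalemxAl dotvZr !range_invE !e -dotvZr scalemxAl -invmxZ ?posdef_unit //.
apply: loewner_inv => //; first exact: posdef_restrict.
move=> x; rewrite -scalemxAl dotvZr mulmx1 -!mulmxA.
rewrite dotv_trmx trmxK [in X in _ <= X]dotv_trmx trmxK.
by have := AL (U *m x); rewrite mul_scalar_mx dotvZr.
Qed.

(** * Averaging over signed row permutations *)

Definition signed_perm d : Type := ({perm 'I_d} * {ffun 'I_d -> bool})%type.
HB.instance Definition _ d := Finite.on (signed_perm d).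

Definition sperm_mx (R : realType) d (g : signed_perm d) : 'M[R]_d :=
  \matrix_(i, j) ((-1) ^+ g.2 i * (g.1 i == j)%:R).

Definition sperm_act (R : realType) d k (g : signed_perm d) (U : 'M[R]_(d, k)) : 'M[R]_(d, k) :=
  \matrix_(i, j) ((-1) ^+ g.2 i * U (g.1 i) j).

Lemma sperm_actE (R : realType) d k (g : signed_perm d) (U : 'M[R]_(d, k)) :
  sperm_act g U = sperm_mx R g *m U.
Proof.
apply/matrixP => i j; rewrite !mxE (bigD1 (g.1 i)) //= mxE eqxx mulr1.
rewrite big1 ?addr0 // => l; rewrite mxE eq_sym => /negbTE ->.
by rewrite mulr0 mul0r.
Qed.

Lemma sperm_mx_orth (R : realType) d (g : signed_perm d) :
  (sperm_mx R g)^T *m sperm_mx R g = 1%:M.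
Proof.
suff : sperm_mx R g *m (sperm_mx R g)^T = 1%:M by move/mulmx1C.
apply/matrixP => i j; rewrite -sperm_actE !mxE.
have [->|ij] := eqVneq i j; first by rewrite eqxx mulr1 -expr2 sqrr_sign.
by rewrite (inj_eq perm_inj) eq_sym (negbTE ij) !mulr0.
Qed.

Lemma sperm_act_gram (R : realType) d k (g : signed_perm d) (U : 'M[R]_(d, k)) :
  (sperm_act g U)^T *m sperm_act g U = U^T *m U.
Proof. by rewrite sperm_actE trmx_mul -mulmxA [_ *m (_ *m U)]mulmxA sperm_mx_orth mul1mx. Qed.

Lemma full_col_rank_sperm (R : realType) d k (g : signed_perm d) (U : 'M[R]_(d, k)) :
  full_col_rank (sperm_act g U) = full_col_rank U.
Proof. by rewrite /full_col_rank sperm_act_gram. Qed.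

Lemma range_inv_sperm (R : realType) d k (g : signed_perm d) (U : 'M[R]_(d, k)) i j :
  range_inv 1%:M (sperm_act g U) i j =
  (-1) ^+ g.2 i * (-1) ^+ g.2 j * range_inv 1%:M U (g.1 i) (g.1 j).
Proof.
rewrite !range_invE !mulmx1 sperm_act_gram {1}sperm_actE.
rewrite -!mulmxA -sperm_actE mxE -mulrA; congr (_ * _).
by rewrite !mulmxA !mxE mulr_sumr; apply: eq_bigr => l _; rewrite !mxE mulrCA.
Qed.

Lemma mxtrace_range_inv1 (R : realType) d k (U : 'M[R]_(d, k)) :
  full_col_rank U -> \tr (range_inv 1%:M U) = k%:R.
Proof.
by move=> fU; rewrite range_invE mulmx1 -mulmxA mxtrace_mulC -mulmxA mulVmx // mxtrace1.
Qed.

(** A sign change of one row is a bijection of the group that negates the off-diagonal entries in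
    that row, so they vanish. Transpositions make the diagonal constant, and the trace [k] of each
    projector fixes its value. The factor [d] stands on the left to avoid a division. *)
Lemma sum_range_inv_sperm (R : realType) d k (U : 'M[R]_(d, k)) :
  full_col_rank U ->
  d%:R *: \sum_(g : signed_perm d) range_inv 1%:M (sperm_act g U) =
  (#|{: signed_perm d}|%:R * k%:R)%:M.
Proof.
move=> fU; set X := \sum_g _.
have XE i j : X i j = \sum_g range_inv 1%:M (sperm_act g U) i j by rewrite summxE.
have off i j : i != j -> X i j = 0.
  move=> ij; pose flip (g : signed_perm d) : signed_perm d :=
    (g.1, [ffun l => (l == i) (+) g.2 l]).
  have flipK : involutive flip.
    move=> [s e]; rewrite /flip /=; congr (_, _).
    by apply/ffunP => l; rewrite !ffunE addbA addbb.
  have : X i j = - X i j.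
    rewrite {1}XE (reindex_inj (inv_inj flipK)) XE -sumrN.
    apply: eq_bigr => g _; rewrite !range_inv_sperm /= !ffunE eqxx.
    by rewrite eq_sym (negbTE ij) /= signrN !mulNr.
  by lra.
have diag i j : X i i = X j j.
  pose sw (g : signed_perm d) : signed_perm d := ((tperm i j * g.1)%g, g.2).
  have swK : involutive sw.
    by move=> [s e]; rewrite /sw /= mulgA tperm2 mul1g.
  rewrite {1}XE (reindex_inj (inv_inj swK)) XE.
  apply: eq_bigr => g _; rewrite !range_inv_sperm /= !permM tpermL -!expr2.
  by rewrite !sqrr_sign.
have trX : \tr X = #|{: signed_perm d}|%:R * k%:R.
  rewrite /X raddf_sum /= (eq_bigr (fun=> k%:R)) => [|g _].
    by rewrite sumr_const mulr_natl.
  by rewrite mxtrace_range_inv1 ?full_col_rank_sperm.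
apply/matrixP => i j; rewrite !mxE.
have [<-|ij] := eqVneq i j; last by rewrite off // mulr0.
rewrite mulr1n -trX /mxtrace (eq_bigr (fun=> X i i)) => [|l _]; last exact: diag.
by rewrite sumr_const card_ord mulr_natl.
Qed.

Lemma sum_mxtrace_sperm (R : realType) d k (U : 'M[R]_(d, k)) (B : 'M[R]_d) :
  (0 < d)%N -> full_col_rank U ->
  \sum_(g : signed_perm d) \tr (range_inv 1%:M (sperm_act g U) *m B) =
  #|{: signed_perm d}|%:R * (k%:R / d%:R) * \tr B.
Proof.
move=> d0 fU; have dn0 : d%:R != 0 :> R by rewrite pnatr_eq0 -lt0n.
rewrite -(raddf_sum (@mxtrace R d)) /= -mulmx_suml.
have -> : \sum_(g : signed_perm d) range_inv 1%:M (sperm_act g U) =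
   (#|{: signed_perm d}|%:R * (k%:R / d%:R))%:M.
  apply: (scalerI dn0); rewrite sum_range_inv_sperm // scale_scalar_mx.
  by congr (_%:M); field.
by rewrite mul_scalar_mx linearZ.
Qed.

Lemma sum_block_update_mxtrace rule (R : realType) d k (L mu : R) (G A : 'M[R]_d)
    (U : 'M[R]_(d, k)) :
  (0 < d)%N -> 0 < mu -> 0 < L -> full_col_rank U -> posdef A -> posdef G -> loewner_le A G ->
  loewner_le A L%:M -> loewner_le mu%:M A ->
  \sum_(g : signed_perm d) \tr (invmx A *m (block_update rule G A (sperm_act g U) - A)) <=
  #|{: signed_perm d}|%:R * ((1 - k%:R / (d%:R * (L / mu))) * \tr (invmx A *m (G - A))).
Proof.
move=> d0 mu0 L0 fU pA pG AG AL muA.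
have dn0 : d%:R != 0 :> R by rewrite pnatr_eq0 -lt0n.
have Ln0 : L != 0 by rewrite gt_eqF.
have mn0 : mu != 0 by rewrite gt_eqF.
have pR : psd (G - A) by apply/psd_loewner; rewrite ?pA.1 ?pG.1.
have h1 g : \tr (invmx A *m (block_update rule G A (sperm_act g U) - A)) <=
    \tr (invmx A *m (G - A)) - L^-1 * \tr (range_inv 1%:M (sperm_act g U) *m (G - A)).
  have fgU : full_col_rank (sperm_act g U) by rewrite full_col_rank_sperm.
  apply: le_trans (block_update_mxtrace rule pA pG fgU) _.
  rewrite lerD2l lerN2 -linearZ /= scalemxAl; apply: mxtrace_mul_loewner => //.
  - by rewrite linearZ /= range_inv_trmx // trmx1.
  - by rewrite range_inv_trmx // pA.1.
  - exact: range_inv_scale_ge.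
apply: le_trans (ler_sum _ (fun g _ => h1 g)) _.
rewrite sumrB sumr_const -mulr_sumr sum_mxtrace_sperm // -[_ *+ _]mulr_natl.
(* The averaged gain is a Euclidean trace; [A^-1 <= mu^-1] turns it back into the trace weighted by
   [A^-1], which supplies the [mu] of the condition number. *)
have h2 : mu * \tr (invmx A *m (G - A)) <= \tr (G - A).
  have : \tr (invmx A *m (G - A)) <= \tr (invmx mu%:M *m (G - A)).
    apply: mxtrace_mul_loewner => //; first exact: (posdef_inv pA).1.
      by rewrite invmx_scalar tr_scalar_mx.
    have pm : posdef (mu%:M : 'M[R]_d) by rewrite -scalemx1; apply/posdef_scale/posdef1.
    exact: loewner_inv.
  by rewrite invmx_scalar mul_scalar_mx linearZ /= ler_pdivlMl.
set N := #|_|%:R; set s := \tr _ in h2 *; set r := \tr _ in h2 *.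
have -> : N * s - L^-1 * (N * (k%:R / d%:R) * r) = N * (s - k%:R / (d%:R * L) * r).
  by field; apply/andP.
apply: ler_wpM2l; first exact: ler0n.
rewrite mulrBl mul1r lerD2l lerN2.
have -> : k%:R / (d%:R * (L / mu)) * s = k%:R / (d%:R * L) * (mu * s).
  by field; apply/and3P.
by apply: ler_wpM2l => //; rewrite divr_ge0 ?ler0n // mulr_ge0 ?ler0n // ltW.
Qed.

(** * Gradient and Hessian *)

Lemma differentiable_dotv (R : realType) d (w : 'cV[R]_d) (g : 'cV[R]_d -> 'cV[R]_d) x :
  differentiable g x -> differentiable (fun y => dotv w (g y)) x.
Proof.
move=> dg.
have -> : (fun y => dotv w (g y)) = \sum_(i < d) (w i 0 *: (fun y => g y i 0)).
  by apply/funext => y; rewrite dotvE fct_sumE.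
apply: differentiable_sum => i; apply: differentiableZ.
exact: (differentiable_comp dg (differentiable_coord _ _ _)).
Qed.

Lemma cV_sum_delta (R : realType) d (v : 'cV[R]_d) :
  v = \sum_i v i 0 *: delta_mx i 0.
Proof.
apply/matrixP => i j; rewrite ord1 summxE (bigD1 i) //= !mxE !eqxx mulr1.
by rewrite big1 ?addr0 // => l li; rewrite !mxE eq_sym (negbTE li) mulr0.
Qed.

Lemma derive_gradient (R : realType) d (f : 'cV[R]_d -> R) x v :
  differentiable f x -> 'D_v f x = dotv (gradient f x) v.
Proof.
move=> df; rewrite deriveE // {1}(cV_sum_delta v) linear_sum /= dotvE.
apply: eq_bigr => i _; rewrite linearZ /= mxE deriveE //.
by rewrite mulrC.
Qed.

Lemma derive_dotv_gradient (R : realType) d (f : 'cV[R]_d -> R) x w v :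
  differentiable (gradient f) x ->
  'D_v (fun y => dotv w (gradient f y)) x = dotv w (hessian f x *m v).
Proof.
move=> dg.
have dc i : differentiable (fun y => gradient f y i 0) x.
  exact: (differentiable_comp dg (differentiable_coord _ _ _)).
have -> : (fun y => dotv w (gradient f y)) =
    \sum_(i < d) (w i 0 *: (fun y => gradient f y i 0)).
  by apply/funext => y; rewrite dotvE fct_sumE.
rewrite derive_sum => [|i]; last exact/derivableZ/diff_derivable.
rewrite dotvE; apply: eq_bigr => i _.
rewrite deriveZ /=; last exact: diff_derivable.
congr (_ * _); rewrite deriveE // {1}(cV_sum_delta v) linear_sum /= mxE.
apply: eq_bigr => j _; rewrite linearZ /= mxE deriveE //.
by rewrite mulrC.
Qed.

Lemma is_derive_line (R : realType) d (F : 'cV[R]_d -> R) x v (t : R) :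
  differentiable F (x + t *: v) ->
  is_derive t (1 : R) (fun s : R => F (x + s *: v)) ('D_v F (x + t *: v)).
Proof.
move=> dF; have dv := @diff_derivable _ _ _ _ _ v dF.
have E : (fun h => h^-1 *: (((fun s => F (x + s *: v)) \o shift t) (h *: 1) - F (x + t *: v)))
  = (fun h => h^-1 *: ((F \o shift (x + t *: v)) (h *: v) - F (x + t *: v))).
  apply/funext => h /=; congr (_ *: (F _ - _)).
  by rewrite [h%:A]mulr1 scalerDl addrCA.
by apply: DeriveDef; rewrite /derivable /derive E.
Qed.

Lemma MVT01 (R : realType) (g dg : R -> R) :
  (forall t : R, is_derive t (1 : R) g (dg t)) ->
  exists2 c, 0 < c < 1 & g 1 - g 0 = dg c.
Proof.
move=> h; have [|c c01 ->] := @MVT R g dg 0 1 ltr01 (fun t _ => h t).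
  apply: continuous_subspaceT => t.
  by apply/differentiable_continuous/derivable1_diffP; case: (h t).
by exists c; [rewrite in_itv in c01|rewrite subr0 mulr1].
Qed.

Lemma derive_ge (R : realType) d (F : 'cV[R]_d -> R) x v (c e : R) :
  differentiable F x -> 0 < e ->
  (forall h, 0 < h < e -> c * h <= F (x + h *: v) - F x) -> c <= 'D_v F x.
Proof.
move=> dF e0 H; have dv := @diff_derivable _ _ _ _ _ v dF.
have cq : (fun h => h^-1 *: ((F \o shift x) (h *: v) - F x)) @ (0 : R)^'+ --> 'D_v F x.
  move=> A /dv /nbhs_ballP [_ /posnumP[r] xrA].
  by exists r%:num => //= y yr /gt_eqF/negbT/xrA; exact.
apply: (cvgr_to_ge cq).
near=> h; have h0 : 0 < h by near: h; exact: nbhs_right_gt.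
rewrite /= [_ *: _]mulrC ler_pdivlMr // [h *: v + x]addrC; apply: H.
by rewrite h0; near: h; exact: nbhs_right_lt.
Unshelve. all: by end_near. Qed.

Lemma derive_le (R : realType) d (F : 'cV[R]_d -> R) x v (c e : R) :
  differentiable F x -> 0 < e ->
  (forall h, 0 < h < e -> F (x + h *: v) - F x <= c * h) -> 'D_v F x <= c.
Proof.
move=> dF e0 H; rewrite -[c]opprK lerNr -deriveN; last exact: diff_derivable.
apply: derive_ge e0 _; first exact: differentiableN.
by move=> h /H; rewrite -![(- F) _]/(- (F _)) mulNr; lra.
Qed.

Lemma enorm_sqr (R : realType) d (v : 'cV[R]_d) : enorm v ^+ 2 = dotv v v.
Proof. by rewrite sqr_sqrtr // dotv_ge0. Qed.

Lemma enorm_ge0 (R : realType) d (v : 'cV[R]_d) : 0 <= enorm v.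
Proof. exact: sqrtr_ge0. Qed.

Lemma strongly_convex_grad (R : realType) d (mu : R) (f : 'cV[R]_d -> R) x v :
  0 <= mu -> strongly_convex mu f -> differentiable f x ->
  dotv (gradient f x) v + mu / 2 * dotv v v <= f (x + v) - f x.
Proof.
move=> mu0 sc df; rewrite -lerBrDr -derive_gradient //.
set K := mu / 2 * _; set B := f (x + v) - f x.
have K0 : 0 <= K by rewrite mulr_ge0 ?dotv_ge0 // divr_ge0.
have H (e : R) : 0 < e < 1 -> 'D_v f x <= B - (1 - e) * K.
  move=> /andP[e0 e1]; apply: (derive_le df e0) => h /andP[h0 he].
  have := @sc (x + v) x h; rewrite ltW //= => /(_ (ltW (lt_trans he e1))).
  rewrite [x + v - x]addrAC subrr add0r enorm_sqr.
  rewrite scalerDr scalerBl scale1r [x - _]addrC addrACA subrr add0r [_ + x]addrC.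
  have -> : h * (1 - h) * mu / 2 * dotv v v = h * ((1 - h) * K) by rewrite /K; ring.
  have : h * ((1 - e) * K) <= h * ((1 - h) * K).
    by apply: ler_wpM2l; [exact: ltW|apply: ler_wpM2r => //; lra].
  by rewrite /B; lra.
(* The limit [e -> 0] in [H], by contradiction: a gap [g > 0] is refuted by [e = g / (g + K + 1)],
   for which [e K < g]. *)
rewrite leNgt; apply/negP => lt; set g := 'D_v f x - (B - K).
have g0 : 0 < g by rewrite subr_gt0.
have gp : 0 < g + K + 1 by lra.
have [] : g / (g + K + 1) * K < g /\ 0 < g / (g + K + 1) < 1.
  rewrite divr_gt0 //= ltr_pdivrMr // mul1r mulrAC ltr_pdivrMr //.
  by split; [rewrite ltr_pM2l //; lra|lra].
by set e := g / _ => eK /H; rewrite /g in eK; lra.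
Qed.

Lemma strongly_convex_mono (R : realType) d (mu : R) (f : 'cV[R]_d -> R) x v :
  0 <= mu -> strongly_convex mu f -> (forall x, differentiable f x) ->
  mu * dotv v v <= dotv v (gradient f (x + v) - gradient f x).
Proof.
move=> mu0 sc df; have := strongly_convex_grad v mu0 sc (df x).
have := strongly_convex_grad (- v) mu0 sc (df (x + v)).
rewrite !dotvM addrK !(dotvC _ v); lra.
Qed.

Lemma hessian_ge (R : realType) d (mu : R) (f : 'cV[R]_d -> R) x :
  0 <= mu -> strongly_convex mu f -> twice_differentiable f ->
  loewner_le mu%:M (hessian f x).
Proof.
move=> mu0 sc [df dg] v; rewrite mul_scalar_mx dotvZr -derive_dotv_gradient //.
apply: (derive_ge (e := 1)) => //; first exact: differentiable_dotv.
move=> h /andP[h0 _]; have := strongly_convex_mono x (h *: v) mu0 sc df.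
rewrite !dotvM => H; rewrite -(ler_pM2l h0); move: H.
by congr (_ <= _); ring.
Qed.

Lemma dotv_CS (R : realType) d (u v : 'cV[R]_d) : dotv u v <= enorm u * enorm v.
Proof.
have := psd_CS u v (posdef_psd (@posdef1 R d)); rewrite !mul1mx => h.
apply: le_trans (ler_norm _) _; rewrite -sqrtr_sqr -sqrtrM ?dotv_ge0 //.
exact: ler_wsqrtr.
Qed.

Lemma hessian_le (R : realType) d (L : R) (f : 'cV[R]_d -> R) x :
  smooth L f -> twice_differentiable f -> loewner_le (hessian f x) L%:M.
Proof.
move=> sL [df dg] v; rewrite mul_scalar_mx dotvZr -derive_dotv_gradient //.
apply: (derive_le (e := 1)) => //; first exact: differentiable_dotv.
move=> h /andP[h0 _]; rewrite -dotvBr; apply: le_trans (dotv_CS _ _) _.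
have := sL (x + h *: v) x; rewrite [x + _ - x]addrAC subrr add0r => H.
apply: le_trans (ler_wpM2l (enorm_ge0 _) H) _.
have -> : enorm (h *: v) = h * enorm v.
  by rewrite /enorm !dotvM mulrA -expr2 sqrtrM ?sqr_ge0 // sqrtr_sqr gtr0_norm.
by rewrite -enorm_sqr le_eqVlt; apply/orP; left; apply/eqP; ring.
Qed.

Lemma dotv_gradient_approx (R : realType) d (f : 'cV[R]_d -> R) x w (e : R) :
  differentiable (gradient f) x -> 0 < e -> exists2 r, 0 < r &
  forall h : 'cV[R]_d, `|h| < r ->
    `| dotv w (gradient f (x + h)) - dotv w (gradient f x) - dotv w (hessian f x *m h) |
      <= e * `|h|.
Proof.
move=> dg e0; have dF := differentiable_dotv w dg.
have /eqaddoP/(_ e e0) := diff_locally dF.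
move=> /nbhs_normP[r r0 H]; exists r => // h hr.
have := H h; rewrite /= sub0r normrN => /(_ hr).
by rewrite !fctE /= opprD addrA -derive_dotv_gradient // deriveE // [h + x]addrC.
Qed.

(** The mean value theorem along [a] turns the second difference into [h] times a difference of
    gradients at two points near [x]; both gradients are then expanded at [x], where the gradient is
    differentiable. *)
Lemma second_difference (R : realType) d (f : 'cV[R]_d -> R) x a b (e : R) :
  twice_differentiable f -> 0 < e -> exists2 r, 0 < r & forall h, 0 < h < r ->
  `| f (x + h *: b + h *: a) - f (x + h *: a) - f (x + h *: b) + f x
     - h ^+ 2 * dotv a (hessian f x *m b) | <= e * h ^+ 2.
Proof.
(* [h C] bounds the total length of the two increments at which the gradient is expanded; the
   summand 1 keeps [C] positive. *)
move=> [df dg] e0; pose C := `|b| + 2 * `|a| + 1.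
have C0 : 0 < C by rewrite /C ltr_wpDl // addr_ge0 // mulr_ge0.
have eC : 0 < e / C by rewrite divr_gt0.
have [r r0 H] := dotv_gradient_approx a (dg x) eC.
exists (r / C) => [|h /andP[h0 hr]]; first by rewrite divr_gt0.
pose g t := f (x + h *: b + t *: (h *: a)) - f (x + t *: (h *: a)).
pose G y := dotv a (gradient f y).
have dgt (t : R) : is_derive t (1 : R) g
    (h * (G (x + h *: b + t *: (h *: a)) - G (x + t *: (h *: a)))).
  have := is_deriveB (is_derive_line (df (x + h *: b + t *: (h *: a))))
                     (is_derive_line (df (x + t *: (h *: a)))).
  by rewrite !derive_gradient // !dotvZr -mulrBr !(dotvC (gradient _ _)).
have [t /andP[t0 t1]] := MVT01 dgt.
rewrite /g !scale1r !scale0r !addr0 => E.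
have -> : f (x + h *: b + h *: a) - f (x + h *: a) - f (x + h *: b) + f x =
   h * (G (x + h *: b + t *: (h *: a)) - G (x + t *: (h *: a))).
  by rewrite -E; ring.
have n1 : `|h *: b + t *: (h *: a)| <= h * (`|b| + `|a|).
  apply: le_trans (ler_normD _ _) _; rewrite !normrZ !gtr0_norm // mulrDr lerD2l.
  by apply: ler_piMl; [rewrite mulr_ge0 // ltW|exact: ltW].
have n2 : `|t *: (h *: a)| <= h * `|a|.
  rewrite !normrZ !gtr0_norm //; apply: ler_piMl; [rewrite mulr_ge0 // ltW //|exact: ltW].
have hC : h * C < r by rewrite -ltr_pdivlMr.
have H1 := H (h *: b + t *: (h *: a)).
have H2 := H (t *: (h *: a)).
have k1 : `|h *: b + t *: (h *: a)| < r.
  apply: le_lt_trans n1 (le_lt_trans _ hC); rewrite ler_wpM2l ?ltW // /C.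
  by have := normr_ge0 a; lra.
have k2 : `|t *: (h *: a)| < r.
  apply: le_lt_trans n2 (le_lt_trans _ hC); rewrite ler_wpM2l ?ltW // /C.
  by have := normr_ge0 a; have := normr_ge0 b; lra.
move: {H1 H2} (H1 k1) (H2 k2); rewrite addrA -!/(G _).
rewrite mulmxDr dotvDr -scalemxAr dotvZr.
set D1 := G _; set D2 := G (x + t *: _); set D0 := G x; set q := dotv a (hessian f x *m b).
set q2 := dotv a _ => H1 H2.
have -> : h * (D1 - D2) - h ^+ 2 * q = h * ((D1 - D0 - (h * q + q2)) - (D2 - D0 - q2)).
  by ring.
rewrite normrM gtr0_norm // expr2 mulrCA ler_pM2l //.
apply: le_trans (ler_normB _ _) _; apply: le_trans (lerD H1 H2) _.
rewrite -mulrDr; apply: (@le_trans _ _ (e / C * (h * C))); last first.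
  by rewrite mulrCA mulrA mulrA mulfVK ?gt_eqF // mulrC.
rewrite ler_pM2l //; apply: le_trans (lerD n1 n2) _.
by rewrite -mulrDr ler_pM2l // /C; lra.
Qed.

(* Schwarz' theorem from differentiability of the gradient alone: the symmetric
   second difference approximates both mixed derivatives. *)
Lemma hessian_trmx (R : realType) d (f : 'cV[R]_d -> R) x :
  twice_differentiable f -> (hessian f x)^T = hessian f x.
Proof.
move=> tf; apply/matrixP => i j; rewrite mxE.
suff H a b : dotv a (hessian f x *m b) <= dotv b (hessian f x *m a).
  by apply/eqP; rewrite eq_le -!dotv_delta !H.
apply/ler_addgt0Pr => e e0; have e2 : 0 < e / 2 by rewrite divr_gt0.
have [r1 r10 H1] := second_difference x a b tf e2.
have [r2 r20 H2] := second_difference x b a tf e2.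
pose h := Num.min r1 r2 / 2.
have m0 : 0 < Num.min r1 r2 by rewrite lt_min r10 r20.
have h0 : 0 < h by rewrite divr_gt0.
have hm : h < Num.min r1 r2 by rewrite /h; lra.
move: hm; rewrite lt_min => /andP[h1 h2].
have := H1 h; rewrite h0 h1 => /(_ isT); have := H2 h; rewrite h0 h2 => /(_ isT).
rewrite [x + h *: a + h *: b]addrAC.
set S := f (_ + _ + _); set fa := f (x + h *: a); set fb := f (x + h *: b).
rewrite !ler_norml => /andP[_ k1] /andP[k2 _].
rewrite -(ler_pM2l (exprn_gt0 2 h0)) mulrDr.
by move: k1 k2; rewrite [_ * h ^+ 2]mulrC; lra.
Qed.

(** * One quasi-Newton step *)

Lemma trmxB (R : realType) m n (A B : 'M[R]_(m, n)) : (A - B)^T = A^T - B^T.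
Proof. exact: linearB. Qed.

Lemma trmxZ (R : realType) m n (a : R) (A : 'M[R]_(m, n)) : (a *: A)^T = a *: A^T.
Proof. exact: linearZ. Qed.

Lemma mxtraceMZr (R : realType) n (a : R) (A B : 'M[R]_n) :
  \tr (A *m (a *: B)) = a * \tr (A *m B).
Proof. by rewrite -scalemxAr linearZ. Qed.

Lemma mxtraceMZl (R : realType) n (a : R) (A B : 'M[R]_n) :
  \tr ((a *: A) *m B) = a * \tr (A *m B).
Proof. by rewrite -scalemxAl linearZ. Qed.

Lemma symmx_sub (R : realType) n (A B : 'M[R]_n) :
  A^T = A -> B^T = B -> (A - B)^T = A - B.
Proof. by move=> sA sB; rewrite trmxB sA sB. Qed.

Lemma loewner_scale_trans (R : realType) n (c eta : R) (A B G : 'M[R]_n) :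
  0 <= c -> 0 <= eta -> loewner_le A (c *: B) -> loewner_le G (eta *: A) ->
  loewner_le (c *: G) ((c ^+ 2 * eta) *: B).
Proof.
move=> c0 e0 AB GA v; have := GA v; have := AB v.
rewrite -!scalemxAl !dotvZr => h1 h2; rewrite expr2 -!mulrA; apply: ler_wpM2l => //.
by apply: le_trans h2 _; rewrite mulrCA; apply: ler_wpM2l.
Qed.

Lemma loewner_scale_le (R : realType) n (c : R) (A B G : 'M[R]_n) :
  0 <= c -> loewner_le B (c *: A) -> loewner_le A G -> loewner_le B (c *: G).
Proof.
move=> c0 BA AG v; apply: le_trans (BA v) _.
by rewrite -!scalemxAl !dotvZr; apply: ler_wpM2l.
Qed.

Local Opaque hessian gradient.

Lemma hnorm_ge0 (R : realType) d (f : 'cV[R]_d -> R) z v : 0 <= hnorm f z v.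
Proof. exact: sqrtr_ge0. Qed.

Lemma hnormZ (R : realType) d (f : 'cV[R]_d -> R) z v (t : R) :
  hnorm f z (t *: v) = `|t| * hnorm f z v.
Proof.
rewrite /hnorm -scalemxAr dotvZl dotvZr mulrA -expr2 sqrtrM ?sqr_ge0 //.
by rewrite sqrtr_sqr.
Qed.

Lemma hnormN (R : realType) d (f : 'cV[R]_d -> R) z v :
  hnorm f z (- v) = hnorm f z v.
Proof. by rewrite -scaleN1r hnormZ normrN1 mul1r. Qed.

(* Polarization. *)
Lemma form_bound (R : realType) d (A D : 'M[R]_d) (k : R) u v :
  posdef A -> D^T = D -> 0 <= k ->
  (forall w, `|dotv w (D *m w)| <= k * dotv w (A *m w)) ->
  dotv u (D *m v) <= k * (Num.sqrt (dotv u (A *m u)) * Num.sqrt (dotv v (A *m v))).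
Proof.
move=> pA sD k0 H.
have [->|u0] := eqVneq u 0.
  by rewrite dotv0l mulr_ge0 // mulr_ge0 // sqrtr_ge0.
have [->|v0] := eqVneq v 0.
  by rewrite mulmx0 dotv0r mulr_ge0 // mulr_ge0 // sqrtr_ge0.
have sq w : w != 0 -> 0 < Num.sqrt (dotv w (A *m w)) by move=> /pA.2; rewrite sqrtr_gt0.
set a := Num.sqrt _; set b := Num.sqrt (dotv v _).
have a0 : 0 < a by exact: sq.
have b0 : 0 < b by exact: sq.
have ea : dotv u (A *m u) = a ^+ 2 by rewrite sqr_sqrtr // (posdef_psd pA).2.
have eb : dotv v (A *m v) = b ^+ 2 by rewrite sqr_sqrtr // (posdef_psd pA).2.
(* Both vectors are normalised in the A-norm. In the difference of the two bounds the D-forms leave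
   four times the mixed term, and by the parallelogram law the A-forms add up to 4. *)
have := H (a^-1 *: u + b^-1 *: v); have := H (a^-1 *: u - b^-1 *: v).
rewrite !mulmxDr !mulmxN -!scalemxAr !dotvM ea eb (dotv_sym v u sD) (dotv_sym v u pA.1).
rewrite !ler_norml => /andP[h1 _] /andP[_ h2].
have := lerB h2 h1; set x := dotv u (D *m v); set y := dotv u (A *m v).
set p := dotv u (D *m u); set q := dotv v (D *m v).
move=> h; suff : 4 * (x / (a * b)) <= 4 * k.
  by rewrite ler_pM2l // ler_pdivrMr // mulr_gt0.
by move: h; congr (_ <= _); field; rewrite !gt_eqF.
Qed.

(** The points [z] and [w] of self-concordance are free, so both can stay at [x] when [x] and [y]
    are exchanged for the lower bound. *)
Lemma ssc_abs (R : realType) d (f : 'cV[R]_d -> R) (M : R) x y w :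
  strongly_self_concordant M f ->
  `|dotv w ((hessian f y - hessian f x) *m w)| <=
    M * hnorm f x (y - x) * dotv w (hessian f x *m w).
Proof.
move=> hM; rewrite ler_norml; apply/andP; split; last first.
  by have := hM x y x x w; rewrite -scalemxAl dotvZr.
rewrite lerNl -dotvNr -mulNmx opprB.
by have := hM y x x x w; rewrite -scalemxAl dotvZr -[x - y]opprB hnormN.
Qed.

Lemma gradient_step (R : realType) d (f : 'cV[R]_d -> R) (M : R) x s v :
  twice_differentiable f -> 0 <= M -> strongly_self_concordant M f ->
  posdef (hessian f x) ->
  dotv v (gradient f (x + s)) <= dotv v (gradient f x + hessian f x *m s)
    + M * hnorm f x s ^+ 2 / 2 * hnorm f x v.
Proof.
move=> tf M0 hM pA; have [df dg] := tf.
set r := hnorm f x s; set N := hnorm f x v; set a := dotv v (hessian f x *m s).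
have [c cE] : exists c, c = M * r ^+ 2 / 2 * N by eexists.
pose G y := dotv v (gradient f y).
(* The Hessian deviation at time [t] is at most [2 c t]. Subtracting its primitive [c t^2] makes the
   derivative of [g] nonpositive, so the mean value theorem replaces an integration and keeps the
   factor [1/2]. *)
pose g := (fun t : R => G (x + t *: s)) - a *: id - c *: (id ^+ 2 : R -> R).
have dgt (t : R) : is_derive t (1 : R) g
   (dotv v (hessian f (x + t *: s) *m s) - a - c * (2 * t)).
  apply: is_derive_eq.
    apply: is_deriveB; apply: is_deriveB.
    exact: (is_derive_line (differentiable_dotv v (dg (x + t *: s)))).
  rewrite derive_dotv_gradient //; congr (_ - _ - _).
    by rewrite [_ *: _]mulr1.
  by rewrite expr1 [_ *: 1]mulr1.
have [t /andP[t0 t1]] := MVT01 dgt.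
have gE u : g u = dotv v (gradient f (x + u *: s)) - a * u - c * u ^+ 2 by [].
rewrite !gE scale1r scale0r addr0 expr1n expr0n /= !mulr0 !subr0 !mulr1.
rewrite dotvDr -cE => E.
have gen (p q w a' c' : R) : p - a' - c' - q = w -> w <= 0 -> p <= q + a' + c'.
  by lra.
apply: (gen _ _ _ _ _ E); rewrite {gen E g dgt gE G}.
have tr : hnorm f x (t *: s) = t * r by rewrite hnormZ gtr0_norm.
have sD : (hessian f (x + t *: s) - hessian f x)^T = hessian f (x + t *: s) - hessian f x.
  exact: symmx_sub (hessian_trmx _ tf) (hessian_trmx _ tf).
have k0 : 0 <= M * (t * r) by rewrite mulr_ge0 // mulr_ge0 ?hnorm_ge0 // ltW.
have H := form_bound v s pA sD k0; rewrite mulmxBl dotvBr in H.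
suff : dotv v (hessian f (x + t *: s) *m s) - a <= M * (t * r) * (N * r).
  rewrite cE => h; apply: le_trans (lerD h (lexx _)) _.
  by rewrite le_eqVlt; apply/orP; left; apply/eqP; field.
have xK : x + t *: s - x = t *: s by rewrite addrAC subrr add0r.
by apply: H => w; have := ssc_abs x (x + t *: s) w hM; rewrite xK tr.
Qed.

Definition sigma (R : realType) d (A G : 'M[R]_d) : R := \tr (invmx A *m (G - A)).

Lemma sigmaE (R : realType) d (A G : 'M[R]_d) :
  posdef A -> sigma A G = \tr (invmx A *m G) - d%:R.
Proof.
by move=> pA; rewrite /sigma mulmxBr linearB /= mulVmx ?posdef_unit // mxtrace1.
Qed.

Lemma sigma_ge0 (R : realType) d (A G : 'M[R]_d) :
  posdef A -> G^T = G -> loewner_le A G -> 0 <= sigma A G.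
Proof.
move=> pA sG AG; apply: psd_mxtrace_mul; first exact: posdef_psd (posdef_inv pA).
by apply/psd_loewner; rewrite ?pA.1.
Qed.

(** [B^-1 <= c A^-1] gives [tr (B^-1 (c G)) <= c^2 tr (A^-1 G)], and
    [tr (A^-1 G) = sigma A G + d]. *)
Lemma sigma_scale (R : realType) d (c : R) (A B G : 'M[R]_d) :
  posdef A -> posdef B -> psd G -> 0 < c -> loewner_le A (c *: B) ->
  sigma B (c *: G) <= c ^+ 2 * sigma A G + d%:R * (c ^+ 2 - 1).
Proof.
move=> pA pB pG c0 AB; rewrite !sigmaE // mxtraceMZr.
have h : \tr (invmx B *m G) <= \tr ((c *: invmx A) *m G).
  apply: mxtrace_mul_loewner => //; first exact: (posdef_inv pB).1.
    by rewrite trmxZ (posdef_inv pA).1.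
  move=> v; have := loewner_inv pA (posdef_scale c0 pB) AB v.
  rewrite (invmxZ (posdef_unit (posdef_scale c0 pB))) -!scalemxAl !dotvZr.
  by rewrite ler_pdivrMl.
rewrite mxtraceMZl in h.
apply: le_trans (lerD (ler_wpM2l (ltW c0) h) (lexx _)) _.
by rewrite le_eqVlt; apply/orP; left; apply/eqP; ring.
Qed.

Lemma sqr_lambda (R : realType) d (f : 'cV[R]_d -> R) x :
  posdef (hessian f x) ->
  lambda f x ^+ 2 = dotv (gradient f x) (invmx (hessian f x) *m gradient f x).
Proof. by move=> /posdef_inv/posdef_psd[_ q]; rewrite sqr_sqrtr. Qed.

Lemma lambda_ge0 (R : realType) d (f : 'cV[R]_d -> R) x : 0 <= lambda f x.
Proof. exact: sqrtr_ge0. Qed.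

Lemma ssc_hessian_le (R : realType) d (f : 'cV[R]_d -> R) (M : R) x y z :
  strongly_self_concordant M f ->
  loewner_le (hessian f y) ((1 + M * hnorm f z (y - x)) *: hessian f x).
Proof.
move=> hM v; have := hM x y z x v.
by rewrite -!scalemxAl !dotvZr mulmxBl dotvBr lerBlDl mulrDl mul1r.
Qed.

Section NewtonStep.
Context (R : realType) (d : nat) (f : 'cV[R]_d -> R) (M : R) (x : 'cV[R]_d) (G : 'M[R]_d).
Let A := hessian f x.
Let s := - (invmx G *m gradient f x).
Let x' := x - invmx G *m gradient f x.
Let A' := hessian f x'.
Let r := hnorm f x (x' - x).

Hypotheses (tf : twice_differentiable f) (M0 : 0 <= M)
  (hM : strongly_self_concordant M f) (pH : forall y, posdef (hessian f y))
  (sG : G^T = G) (AG : loewner_le A G).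

Let pA : posdef A. Proof. exact: pH. Qed.
Let pA' : posdef A'. Proof. exact: pH. Qed.
Let uA : A \in unitmx. Proof. exact: posdef_unit. Qed.
Let uA' : A' \in unitmx. Proof. exact: posdef_unit. Qed.
Let pG : posdef G. Proof. exact: posdef_loewner (pH x) sG AG. Qed.
Let xs : x' = x + s. Proof. by []. Qed.
Let rs : r = hnorm f x s.
Proof. by rewrite /r xs addrAC subrr add0r. Qed.

(** [s^T A s <= s^T G s = g^T G^-1 g <= g^T A^-1 g] with [g] the gradient at [x]. *)
Lemma newton_step_le : r <= lambda f x.
Proof.
rewrite rs; apply: ler_wsqrtr; apply: le_trans (AG _) _.
rewrite /s mulmxN !dotvM opprK mulKVmx ?posdef_unit // dotvC.
exact: (loewner_inv pA pG AG).
Qed.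

Lemma newton_hessian_le : loewner_le A' ((1 + M * r) *: A).
Proof. exact: ssc_hessian_le. Qed.

Lemma newton_hessian_ge : loewner_le A ((1 + M * r) *: A').
Proof. by rewrite /r -opprB hnormN; exact: ssc_hessian_le. Qed.

Let Mr0 : 0 <= M * r. Proof. by rewrite mulr_ge0 // hnorm_ge0. Qed.

Lemma sqrt_one_plus (u : R) : 0 <= u -> Num.sqrt (1 + u) <= 1 + u / 2.
Proof.
move=> u0; rewrite -(ger0_norm (_ : 0 <= 1 + u / 2)); last by lra.
by rewrite -sqrtr_sqr ler_wsqrtr //; nra.
Qed.

(** The new gradient is tested against [v = A'^-1 g'], for which [<v, g'>] is the square of the new
    [lambda]. The summand [M l / 2] is the second order error of the gradient; the factor
    [1 + M l / 2] comes from measuring [v] with [A] instead of [A']. The bound [b] on the linearised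
    gradient is left open because it is used with two different values. *)
Lemma newton_lambda_le (b l : R) : 0 <= b -> 0 <= l ->
  (forall v, dotv v (gradient f x + A *m s) <= b * l * hnorm f x v) ->
  r <= l ->
  lambda f x' <= (1 + M * l / 2) * (b + M * l / 2) * l.
Proof.
move=> b0 l0 H rl; pose v := invmx A' *m gradient f x'.
have r0 : 0 <= r := hnorm_ge0 _ _ _.
have e1 : lambda f x' ^+ 2 = dotv v (gradient f x') by rewrite sqr_lambda // dotvC.
have e2 : lambda f x' ^+ 2 = dotv v (A' *m v).
  by rewrite e1 /v mulKVmx.
have hN : hnorm f x v <= (1 + M * l / 2) * lambda f x'.
  apply: (@le_trans _ _ (Num.sqrt (1 + M * r) * lambda f x')); last first.
    apply: ler_wpM2r; first exact: lambda_ge0.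
    apply: le_trans (sqrt_one_plus Mr0) _; rewrite lerD2l ler_pM2r ?invr_gt0 //.
    exact: ler_wpM2l.
  rewrite -(ger0_norm (lambda_ge0 _ _)) -sqrtr_sqr -sqrtrM ?addr_ge0 //.
  by apply: ler_wsqrtr; have := newton_hessian_ge v; rewrite -scalemxAl dotvZr e2.
have : lambda f x' ^+ 2 <= (b * l + M * l ^+ 2 / 2) * hnorm f x v.
  rewrite e1 xs mulrDl; apply: le_trans (gradient_step _ _ tf M0 hM (pH x)) _.
  apply: lerD; first exact: H.
  apply: ler_wpM2r; first exact: hnorm_ge0.
  rewrite ler_pM2r ?invr_gt0 // -rs; apply: ler_wpM2l => //.
  by rewrite ler_pXn2r ?nnegrE.
move=> h; have := lambda_ge0 f x'; rewrite le_eqVlt => /orP[/eqP <-|lp].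
  by rewrite !mulr_ge0 // addr_ge0 // ?divr_ge0 // mulr_ge0.
rewrite -(ler_pM2r lp) -expr2; apply: le_trans h _.
apply: le_trans (ler_wpM2l _ hN) _.
  by rewrite addr_ge0 // ?divr_ge0 // mulr_ge0 // sqr_ge0.
by rewrite le_eqVlt; apply/orP; left; apply/eqP; field.
Qed.

(** As [G s] is minus the gradient, the linearised gradient is [(A - G) s], and
    [0 <= G - A <= sigma A] because a trace dominates the largest relative eigenvalue. *)
Lemma newton_lambda_sigma :
  lambda f x' <= (1 + M * lambda f x / 2) * (sigma A G + M * lambda f x / 2) * lambda f x.
Proof.
have s0 : 0 <= sigma A G := sigma_ge0 (pH x) sG AG.
apply: newton_lambda_le => //; first exact: lambda_ge0; last exact: newton_step_le.
move=> v; have -> : gradient f x + A *m s = (A - G) *m s.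
  by rewrite mulmxBl /s !mulmxN opprK mulKVmx ?posdef_unit // addrC.
have sA : A^T = A := (pH x).1.
have sD : (A - G)^T = A - G by exact: symmx_sub.
have H := form_bound v s pA sD s0.
apply: le_trans (H _) _ => [w|].
  rewrite -opprB mulNmx dotvNr normrN ger0_norm.
    by apply: loewner_mxtrace => //; apply/psd_loewner.
  by rewrite mulmxBl dotvBr subr_ge0; exact: AG.
rewrite -mulrA; apply: ler_wpM2l => //; rewrite mulrC.
apply: ler_wpM2r; first exact: sqrtr_ge0.
by rewrite -[X in X <= _]/(hnorm f x s) -rs newton_step_le.
Qed.

(** The linearised gradient is [A (A^-1 - G^-1)] applied to the gradient, and
    [y A^-1 <= G^-1 <= A^-1] leaves [0 <= A^-1 - G^-1 <= (1 - y) A^-1]. *)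
Lemma newton_lambda_contract (y : R) : 0 < y <= 1 -> loewner_le G (y^-1 *: A) ->
  lambda f x' <= (1 + M * lambda f x / 2) * (1 - y + M * lambda f x / 2) * lambda f x.
Proof.
move=> /andP[y0 y1] GA.
apply: newton_lambda_le; rewrite ?subr_ge0 ?lambda_ge0 ?newton_step_le // => v.
have sA : A^T = A := (pH x).1.
have -> : dotv v (gradient f x + A *m s) = dotv (A *m v) ((invmx A - invmx G) *m gradient f x).
  rewrite [RHS]dotvC (dotv_sym _ _ sA); congr dotv.
  by rewrite /s mulmxN mulmxBl mulmxBr (mulKVmx uA).
have sD : (invmx A - invmx G)^T = invmx A - invmx G by apply: symmx_sub; rewrite trmx_inv ?sA ?sG.
have k0 : 0 <= 1 - y by rewrite subr_ge0.
have H := form_bound (A *m v) (gradient f x) (posdef_inv pA) sD k0.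
apply: le_trans (H _) _ => [w|].
  have yV0 : 0 < y^-1 by rewrite invr_gt0.
  have h1 := loewner_inv pA pG AG w.
  have h2 := loewner_inv pG (posdef_scale yV0 pA) GA w.
  rewrite (invmxZ (posdef_unit (posdef_scale yV0 pA))) invrK -scalemxAl dotvZr in h2.
  rewrite mulmxBl dotvBr ger0_norm ?subr_ge0 //.
  by rewrite mulrBl mul1r lerD2l lerN2.
rewrite (mulKmx uA) (dotvC (A *m v)) -mulrA; apply: ler_wpM2l => //.
by rewrite mulrC.
Qed.

(** This is the purpose of the factor [1 + M r] in the method: the matrix to be updated stays above
    the new Hessian. *)
Lemma newton_scaled_ge : loewner_le A' ((1 + M * r) *: G).
Proof.
by apply: loewner_scale_le newton_hessian_le AG; rewrite addr_ge0.
Qed.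

Lemma newton_scaled_le (eta : R) : 0 <= eta -> loewner_le G (eta *: A) ->
  loewner_le ((1 + M * r) *: G) (((1 + M * r) ^+ 2 * eta) *: A').
Proof.
by move=> e0 GA; apply: loewner_scale_trans newton_hessian_ge GA; rewrite ?addr_ge0.
Qed.

Lemma newton_scaled_sigma :
  sigma A' ((1 + M * r) *: G) <=
  (1 + M * r) ^+ 2 * sigma A G + d%:R * ((1 + M * r) ^+ 2 - 1).
Proof.
by apply: (sigma_scale pA pA' (posdef_psd pG) _ newton_hessian_ge); rewrite ltr_pwDl.
Qed.

End NewtonStep.

Local Transparent hessian gradient.

(** * The deterministic envelope *)

(* [b] dominates [M lambda] and [y] is dominated by [1 / eta], where
   [eta] is the Loewner ratio of [G] to the Hessian. *)
Fixpoint envelope (R : realType) (b0 y0 : R) (t : nat) : R * R :=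
  if t is s.+1 then
    let: (b, y) := envelope b0 y0 s in (b * (1 - y + b), y / (1 + b) ^+ 2)
  else (b0, y0).

(** The slack [10 * b <= y] propagates because [b / y] does not increase: it is multiplied by
    [(1 - y + b) (1 + b)^2], which is at most 1 when [b] is this small compared with [y]. *)
Definition envelope_ok (R : realType) (b y : R) : Prop :=
  [/\ 0 <= b, 0 < y <= 1 & 10 * b <= y].

(** [p] is what remains of [(1 - y + b) (1 + b)^2] after removing [1 - y] and dividing by [b]. The
    coefficient [169/100] is [2 - 31/100], from [b <= y / 10] and [3 - y + b <= 31/10]. *)
Lemma envelope_ratio (R : realType) (b y : R) : envelope_ok b y ->
  exists p, [/\ 0 <= p <= 3 - 169 / 100 * y, b * p <= y &
    (1 - y + b) * (1 + b) ^+ 2 = 1 - y + b * p].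
Proof.
move=> [b0 /andP[y0 y1] by_]; exists (3 - 2 * y + b * (3 - y + b)); split.
- by apply/andP; split; nra.
- by nra.
- by ring.
Qed.

Lemma envelope_step (R : realType) (b y : R) : envelope_ok b y ->
  envelope_ok (b * (1 - y + b)) (y / (1 + b) ^+ 2).
Proof.
move=> ok; have [b0 /andP[y0 y1] by_] := ok; have [p [/andP[p0 p3] bp e]] := envelope_ratio ok.
have q0 : 0 < (1 + b) ^+ 2 by rewrite exprn_gt0 // ltr_pwDl.
split.
- by rewrite mulr_ge0 //; lra.
- rewrite divr_gt0 //= ler_pdivrMr //; nra.
- rewrite ler_pdivlMr // -!mulrA e; nra.
Qed.

Lemma envelopeP (R : realType) (b0 y0 : R) t : envelope_ok b0 y0 ->
  envelope_ok (envelope b0 y0 t).1 (envelope b0 y0 t).2 /\ (envelope b0 y0 t).1 <= b0.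
Proof.
move=> ok; elim: t => [|t [IH1 IH2]] //=.
move: IH1 IH2; case: (envelope b0 y0 t) => b y /= ok1 h; split; first exact: envelope_step.
by have [? /andP[? ?] ?] := ok1; apply: le_trans h; nra.
Qed.

(* With [z = b / y], the sum of the [b]'s plus [z + 5/2 z^2] is nonincreasing. *)
Lemma envelope_sum (R : realType) (b0 y0 : R) t : envelope_ok b0 y0 ->
  \sum_(i < t) (envelope b0 y0 i).1 <= b0 / y0 * (1 + 5 / 2 * (b0 / y0)).
Proof.
move=> ok; pose z t := (envelope b0 y0 t).1 / (envelope b0 y0 t).2.
have zok s : 0 <= z s.
  by have [[? /andP[? ?] ?] _] := envelopeP s ok; rewrite divr_ge0 // ltW.
suff : \sum_(i < t) (envelope b0 y0 i).1 + z t * (1 + 5 / 2 * z t) <= z 0%N * (1 + 5 / 2 * z 0%N).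
  by apply: le_trans; rewrite lerDl; have := zok t; nra.
elim: t => [|t IH]; first by rewrite big_ord0 add0r.
rewrite big_ord_recr /=; apply: le_trans IH; rewrite -addrA lerD2l /z /=.
have := (envelopeP t ok).1; case: (envelope b0 y0 t) => b y /= ok1.
have [b_ge0 /andP[y_gt0 y1] by_] := ok1; have [p [/andP[p0 p3] bp e]] := envelope_ratio ok1.
have [w wE] : exists w, w = b / y by eexists.
have bE : b = w * y by rewrite wE divfK // gt_eqF.
have w0 : 0 <= w by rewrite wE divr_ge0 // ltW.
have w1 : w <= 1 / 10 by rewrite wE ler_pdivrMr //; lra.
have -> : b * (1 - y + b) / (y / (1 + b) ^+ 2) = w * (1 - y + b * p).
  by rewrite -e wE; field; rewrite !gt_eqF //= ltr_pwDl.
rewrite -wE bE.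
have wp1 : w * p <= 3 / 10 by nra.
(* The decrease to be shown is [w^2 y] times the difference of the two sides of this inequality. *)
suff h : p <= 5 / 2 * ((1 - w * p) * (2 - y + w * y * p)).
  rewrite -subr_ge0.
  have -> : w * (1 + 5 / 2 * w) - (w * y + w * (1 - y + w * y * p) *
      (1 + 5 / 2 * (w * (1 - y + w * y * p)))) =
      w ^+ 2 * y * (5 / 2 * ((1 - w * p) * (2 - y + w * y * p)) - p) by field.
  by rewrite mulr_ge0 ?subr_ge0 // mulr_ge0 ?sqr_ge0 // ltW.
(* Here [7/10] is [1 - 3/10], from [w p <= 3/10]. The coefficient [5/2] is large enough that
   [5/2 * 7/10 * (2 - y) = 7/2 - 7/4 y] exceeds the bound [3 - 169/100 y] on [p]. *)
have h : 7 / 10 * (2 - y) <= (1 - w * p) * (2 - y + w * y * p).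
  apply: ler_pM; [lra|lra|lra|].
  by rewrite lerDl !mulr_ge0 // ltW.
by lra.
Qed.

(** [exp (4/5) >= (6/5)^4 > 2]. *)
Lemma ln2_le (R : realType) : ln 2 <= 4 / 5 :> R.
Proof.
rewrite -ler_expR lnK ?posrE //.
have -> : 4 / 5 = 1 / 5 + 1 / 5 + (1 / 5 + 1 / 5) :> R by lra.
rewrite !expRD; have := @expR_ge1Dx R (1 / 5); set e := expR _ => h.
have h2 : 36 / 25 <= e * e by nra.
by nra.
Qed.

(** [b / y = ln 2 / 4 * rho / d] is at most [1/5 * 1/2 = 1/10], from [ln 2 <= 4/5] and [d >= 2]. *)
Lemma envelope_init (R : realType) (d : nat) (rho eta b : R) :
  (2 <= d)%N -> 0 < rho <= 1 -> 1 <= eta -> b = ln 2 / 4 * (rho / d%:R) / eta ->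
  envelope_ok b eta^-1.
Proof.
move=> d2 /andP[r0 r1] e1 ->.
have d2R : 2 <= d%:R :> R by rewrite (ler_nat R 2).
have d0 : 0 < d%:R :> R by lra.
have q0 : 0 < rho / d%:R by rewrite divr_gt0.
have q1 : rho / d%:R <= 1 / 2 by rewrite ler_pdivrMr; lra.
have l0 : 0 < ln 2 :> R by rewrite ln_gt0 // ltr1n.
have l1 := ln2_le R.
have eta0 : 0 < eta by lra.
have eps0 : 0 <= ln 2 / 4 * (rho / d%:R) by rewrite mulr_ge0 //; lra.
have eps1 : ln 2 / 4 * (rho / d%:R) <= 1 / 10 by nra.
split; rewrite ?invr_gt0 ?eta0 ?invf_le1 //; first by rewrite divr_ge0 // ltW.
by rewrite mulrA ler_pdivrMr // mulVf ?gt_eqF //; lra.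
Qed.

(** The product is at most the exponential of [c] times the sum of the [b]'s. With [q = rho / d] and
    [eps = ln 2 / 4 * q] that exponent is at most [ln 2 * (1 + eps / 2) (1 + 5/2 eps) (1 + q) / 2].
    Since [eps <= 1/10] and [q <= 1/2], the factor after [ln 2] is at most [4/3 * 3/4 = 1]. *)
Lemma envelope_growth (R : realType) (d : nat) (rho eta b : R) t :
  (2 <= d)%N -> 0 < rho <= 1 -> 1 <= eta ->
  b = ln 2 / 4 * (rho / d%:R) / eta ->
  \prod_(i < t) (1 + (1 + (envelope b eta^-1 i).1 / 2) *
     (2 * (envelope b eta^-1 i).1) * (1 + d%:R / rho)) <= 2.
Proof.
move=> d2 r01 e1 bE; have ok := envelope_init d2 r01 e1 bE.
have [[b0 _ b10] /andP[r0 r1]] := (ok, r01).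
have d2R : 2 <= d%:R :> R by rewrite (ler_nat R 2).
have [q qE] : exists q, q = rho / d%:R by eexists.
have [l lE] : exists l : R, l = ln 2 by eexists.
have q0 : 0 < q by rewrite qE divr_gt0 //; lra.
have q1 : q <= 1 / 2 by rewrite qE ler_pdivrMr; lra.
have l0 : 0 < l by rewrite lE ln_gt0 // ltr1n.
have eta0 : 0 < eta by lra.
have [eps epsE] : exists eps, eps = l / 4 * q by eexists.
rewrite -lE -qE -epsE in bE.
have eps0 : 0 <= eps by rewrite epsE mulr_ge0 //; lra.
have eps1 : eps <= 1 / 10.
  have : 10 * eps <= 1; last by lra.
  by move: b10; rewrite bE mulrA ler_pdivrMr // mulVf ?gt_eqF.
have be : b <= eps by rewrite bE ler_pdivrMr //; nra.
pose c := (1 + eps / 2) * 2 * (1 + d%:R / rho).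
have qV : d%:R / rho = q^-1 by rewrite qE invf_div.
have qV0 : 0 < q^-1 by rewrite invr_gt0.
have c0 : 0 <= c by rewrite /c qV !mulr_ge0 //; lra.
apply: (@le_trans _ _ (\prod_(i < t) expR (c * (envelope b eta^-1 i).1))).
  apply: ler_prod => i _; set u := (envelope _ _ i).1.
  have [[u0 _ _] ub] := envelopeP i ok; rewrite -/u in u0 ub.
  have p0 : 0 <= (1 + u / 2) * (2 * u) by rewrite !mulr_ge0 //; lra.
  apply/andP; split; first by rewrite addr_ge0 // mulr_ge0 // qV; lra.
  apply: le_trans (expR_ge1Dx _); rewrite lerD2l /c [X in _ <= X]mulrAC.
  apply: ler_wpM2r; first by rewrite qV; lra.
  by rewrite -mulrA; apply: ler_wpM2r; lra.
rewrite -expR_sum -mulr_sumr -[X in _ <= X](@lnK R) ?posrE // ler_expR -lE.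
have bz : b / eta^-1 = eps by rewrite bE invrK divfK // gt_eqF.
apply: le_trans (ler_wpM2l c0 (envelope_sum t ok)) _; rewrite bz.
have -> : c * (eps * (1 + 5 / 2 * eps)) = l * ((1 + eps / 2) * (1 + 5 / 2 * eps) * ((1 + q) / 2)).
  by rewrite /c qV epsE; field; rewrite gt_eqF.
rewrite -[X in _ <= X]mulr1; apply: ler_wpM2l; first exact: ltW.
have h1 : (1 + eps / 2) * (1 + 5 / 2 * eps) <= 4 / 3 by nra.
have : 0 <= (1 + eps / 2) * (1 + 5 / 2 * eps) by rewrite mulr_ge0 //; lra.
by set v := _ * _ in h1 *; nra.
Qed.

(** The coefficients of [s] agree exactly at [b = u]. The weight [2 D] on [u] is chosen so that
    [2 rho D u] cancels the first order part of the drift [rho D ((1 + u)^2 - 1)]; the remaining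
    terms are of second order in [u] and have the right sign. *)
Lemma growth_step (R : realType) (D rho u b s : R) :
  1 <= D -> 0 < rho -> 0 <= u -> u <= b -> 0 <= s ->
  rho * ((1 + u) ^+ 2 * s + D * ((1 + u) ^+ 2 - 1))
    + 2 * D * ((1 + u / 2) * (s + u / 2) * u) <=
  rho * (1 + (1 + b / 2) * (2 * b) * (1 + D / rho)) * (s + 2 * D * u).
Proof.
move=> D1 r0 u0 ub s0.
have e (w : R) : rho * (1 + (1 + w / 2) * (2 * w) * (1 + D / rho)) =
    rho * (1 + w) ^+ 2 + 2 * D * (1 + w / 2) * w.
  by field; rewrite gt_eqF.
apply: (@le_trans _ _ (rho * (1 + (1 + u / 2) * (2 * u) * (1 + D / rho)) * (s + 2 * D * u))).
  rewrite e -subr_ge0 [X in 0 <= X](_ : _ =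
     D * u * (2 * rho * (1 + u) ^+ 2 - rho * (2 + u) + (1 + u / 2) * u * (4 * D - 1))).
    2: by field.
  rewrite mulr_ge0 //; first by rewrite mulr_ge0 //; lra.
  rewrite addr_ge0 //; last by rewrite !mulr_ge0 //; lra.
  have -> : 2 * rho * (1 + u) ^+ 2 - rho * (2 + u) = rho * (u * (3 + 2 * u)) by ring.
  by rewrite !mulr_ge0 //; lra.
apply: ler_wpM2r; first by rewrite addr_ge0 // !mulr_ge0 //; lra.
rewrite ler_pM2l // lerD2l; apply: ler_wpM2r.
  by rewrite addr_ge0 // divr_ge0 //; lra.
by nra.
Qed.

(** * State invariant and potential *)

Definition next_point (R : realType) d (f : 'cV[R]_d -> R) x (G : 'M[R]_d) : 'cV[R]_d :=
  x - invmx G *m gradient f x.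

Definition next_scaled (R : realType) d (f : 'cV[R]_d -> R) (M : R) x (G : 'M[R]_d) : 'M[R]_d :=
  (1 + M * hnorm f x (next_point f x G - x)) *: G.

Definition state_ok (R : realType) d (f : 'cV[R]_d -> R) (M b y : R) x (G : 'M[R]_d) : Prop :=
  [/\ G^T = G, loewner_le (hessian f x) G, loewner_le G (y^-1 *: hessian f x) &
      M * lambda f x <= b].

Definition potential (R : realType) d (f : 'cV[R]_d -> R) (M : R) x (G : 'M[R]_d) : R :=
  sigma (hessian f x) G + 2 * d%:R * (M * lambda f x).

Lemma loewner_scale_mono (R : realType) d (A : 'M[R]_d) (a c : R) :
  posdef A -> a <= c -> loewner_le (a *: A) (c *: A).
Proof.
move=> pA ac v; rewrite -!scalemxAl !dotvZr; apply: ler_wpM2r => //.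
exact: (posdef_psd pA).2.
Qed.

Lemma envelope_contract (R : realType) (b y u : R) :
  envelope_ok b y -> 0 <= u -> u <= b ->
  (1 + u / 2) * (1 - y + u / 2) * u <= b * (1 - y + b).
Proof.
move=> [b0 /andP[y0 y1] by_] u0 ub.
have h : u / 2 * (1 - y + u / 2) <= u / 2 * 1 by apply: ler_wpM2l; lra.
rewrite mulrC; apply: ler_pM => //; last by lra.
by rewrite mulr_ge0 //; lra.
Qed.

Section Step.
Context (R : realType) (d k : nat) (f : 'cV[R]_d -> R) (M L mu b y : R) (x : 'cV[R]_d)
  (G : 'M[R]_d) (rule : update_rule) (U : 'M[R]_(d, k)).
Hypotheses (tf : twice_differentiable f) (M0 : 0 <= M)
  (hM : strongly_self_concordant M f) (pH : forall y, posdef (hessian f y))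
  (env : envelope_ok b y) (ok : state_ok f M b y x G).

Let sG : G^T = G. Proof. by case: ok. Qed.
Let AG : loewner_le (hessian f x) G. Proof. by case: ok. Qed.
Let x' := next_point f x G.
Let Gt := next_scaled f M x G.
Let r := hnorm f x (x' - x).
Let u := M * lambda f x.

Let ru : M * r <= u.
Proof. by apply: ler_wpM2l => //; exact: newton_step_le. Qed.
Let r0 : 0 <= M * r. Proof. by rewrite mulr_ge0 ?hnorm_ge0. Qed.
Let u0 : 0 <= u. Proof. by rewrite mulr_ge0 ?lambda_ge0. Qed.
Let ub : u <= b. Proof. by case: ok. Qed.

Lemma next_scaled_posdef : posdef Gt.
Proof.
apply: posdef_scale; first by rewrite ltr_pwDl.
exact: posdef_loewner (pH x) sG AG.
Qed.

(** The square in [y / (1 + b) ^+ 2] collects one factor from the rescaling of [G] and one from the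
    change of Hessian. The update itself does not worsen the ratio, being below the DFP update. *)
Lemma state_ok_step : full_col_rank U ->
  state_ok f M (b * (1 - y + b)) (y / (1 + b) ^+ 2) x'
    (block_update rule Gt (hessian f x') U).
Proof.
move=> fU; have [_ _ GA _] := ok; have [b0 /andP[y0 y1] by_] := env.
have q0 : 0 < (1 + b) ^+ 2 by rewrite exprn_gt0 // ltr_pwDl.
have pGt := next_scaled_posdef; have pA' := pH x'.
split.
- by apply: block_update_trmx; [exact: pA'.1|exact: pGt.1].
- by have := block_update_ge rule pA' pGt fU (newton_scaled_ge M0 hM AG).
- rewrite invf_div; apply: loewner_trans (block_update_le_dfp rule pA' pGt fU) _.
  apply: (block_dfp_scale_le pA' fU).
    by rewrite ler_pdivlMr // mul1r; nra.
  have yV : 0 <= y^-1 by rewrite invr_ge0 ltW.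
  apply: loewner_trans (newton_scaled_le M0 hM yV GA) _.
  apply: (loewner_scale_mono pA'); apply: (ler_wpM2r yV).
  by rewrite ler_pXn2r ?nnegrE ?addr_ge0 // lerD2l (le_trans ru).
- have y01 : 0 < y <= 1 by rewrite y0.
  have h := newton_lambda_contract tf M0 hM pH sG AG y01 GA.
  apply: le_trans (ler_wpM2l M0 h) _; rewrite -/u mulrCA -/u.
  exact: envelope_contract env u0 ub.
Qed.

Lemma next_ratio_le : (0 < d)%N ->
  lambda f x' / lambda f x <= (1 + b / 2) * potential f M x G.
Proof.
move=> d0; have [b0 _ _] := env.
have s0 := sigma_ge0 (pH x) sG AG.
have p0 : 0 <= potential f M x G by rewrite addr_ge0 // !mulr_ge0 // lambda_ge0.
have := lambda_ge0 f x; rewrite le_eqVlt => /orP[/eqP <-|lp].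
  (* At a critical point the ratio is 0 by the convention for division by zero. *)
  by rewrite invr0 mulr0 mulr_ge0 //; lra.
rewrite ler_pdivrMr //; apply: le_trans (newton_lambda_sigma tf M0 hM pH sG AG) _.
apply: ler_wpM2r; first exact: ltW.
have u_ge0 := u0; have u_le := ub; rewrite -/u; rewrite /u in u_ge0 u_le *.
apply: ler_pM; [lra| by rewrite addr_ge0 //; lra| by rewrite lerD2l; lra |].
have D1 : 1 <= d%:R :> R by rewrite ler1n.
by rewrite /potential lerD2l mulrC; apply: ler_wpM2r => //; lra.
Qed.

Lemma sum_potential_step : (0 < d)%N -> 0 < mu -> 0 < L ->
  (forall z, loewner_le (hessian f z) L%:M) -> (forall z, loewner_le mu%:M (hessian f z)) ->
  0 < 1 - k%:R / (d%:R * (L / mu)) -> full_col_rank U ->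
  let rho := 1 - k%:R / (d%:R * (L / mu)) in
  \sum_(g : signed_perm d)
    potential f M x' (block_update rule Gt (hessian f x') (sperm_act g U)) <=
  #|{: signed_perm d}|%:R *
    (rho * (1 + (1 + b / 2) * (2 * b) * (1 + d%:R / rho)) * potential f M x G).
Proof.
move=> d0 mu0 L0 AL Amu rho0 fU; set rho := 1 - _ in rho0 *; move=> /=.
have [b0 _ _] := env.
have pGt := next_scaled_posdef; have pA' := pH x'.
have AGt : loewner_le (hessian f x') Gt := newton_scaled_ge M0 hM AG.
(* The next point does not involve the direction drawn, so the [lambda] term is constant over the
   group. *)
rewrite big_split /= sumr_const -[X in _ + X]mulr_natl.
have H := sum_block_update_mxtrace rule d0 mu0 L0 fU pA' pGt AGt (AL _) (Amu _).
apply: le_trans (lerD H (lexx _)) _.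
rewrite -/rho -mulrDr; apply: ler_wpM2l; first exact: ler0n.
have D1 : 1 <= d%:R :> R by rewrite ler1n.
have s0 := sigma_ge0 (pH x) sG AG.
apply: le_trans (growth_step D1 rho0 u0 ub s0); apply: lerD.
  apply: ler_wpM2l; first exact: ltW.
  apply: le_trans (newton_scaled_sigma M0 hM pH sG AG) _.
  have h : (1 + M * r) ^+ 2 <= (1 + u) ^+ 2.
    by rewrite ler_pXn2r ?nnegrE ?addr_ge0 // lerD2l.
  apply: lerD; first exact: ler_wpM2r.
  by apply: ler_wpM2l; rewrite ?ler0n // lerD2r.
apply: ler_wpM2l; first by rewrite mulr_ge0 // ler0n.
apply: le_trans (ler_wpM2l M0 (newton_lambda_sigma tf M0 hM pH sG AG)) _.
by rewrite mulrCA lexx.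
Qed.

End Step.

Lemma iterateS rule (R : realType) d k (f : 'cV[R]_d -> R) M x0 G0 (U : nat -> 'M[R]_(d, k)) t :
  let: (x, G) := iterate rule f M x0 G0 U t in
  iterate rule f M x0 G0 U t.+1 =
    (next_point f x G,
     block_update rule (next_scaled f M x G) (hessian f (next_point f x G)) (U t)).
Proof. by rewrite /=; case: (iterate _ _ _ _ _ _ t). Qed.

(** * Measurability and the coordinate space *)

Definition measurable_mx d (T : measurableType d) (R : realType) m n
    (X : T -> 'M[R]_(m, n)) : Prop :=
  forall i j, measurable_fun [set: T] (fun w => X w i j).

Lemma measurable_invr (R : realType) : measurable_fun [set: R] (fun x : R => x^-1).
Proof.
have -> : [set: R] = [set~ (0 : R)] `|` [set 0] by rewrite setUC setUv.
apply/measurable_funU; [exact: measurableC|by []|split].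
  apply: open_continuous_measurable_fun.
    by apply: closed_openC; exact: closed_eq.
  by move=> x /set_mem /= /eqP x0; exact: inv_continuous.
exact: measurable_fun_set1.
Qed.

Lemma measurable_inv d (T : measurableType d) (R : realType) (g : T -> R) :
  measurable_fun [set: T] g -> measurable_fun [set: T] (fun w => (g w)^-1).
Proof. by move=> mg; exact: (measurableT_comp (@measurable_invr R) mg). Qed.

Lemma measurable_sqrt d (T : measurableType d) (R : realType) (g : T -> R) :
  measurable_fun [set: T] g -> measurable_fun [set: T] (fun w => Num.sqrt (g w)).
Proof.
move=> mg; apply: (measurableT_comp _ mg).
by apply: continuous_measurable_fun; exact: sqrt_continuous.
Qed.

Lemma measurable_mulmx d (T : measurableType d) (R : realType) m n p
    (X : T -> 'M[R]_(m, n)) (Y : T -> 'M[R]_(n, p)) :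
  measurable_mx X -> measurable_mx Y -> measurable_mx (fun w => X w *m Y w).
Proof.
move=> mX mY i j; under eq_fun do rewrite mxE.
by apply: measurable_sum => l; exact: measurable_funM.
Qed.

Lemma measurable_addmx d (T : measurableType d) (R : realType) m n
    (X Y : T -> 'M[R]_(m, n)) :
  measurable_mx X -> measurable_mx Y -> measurable_mx (fun w => X w + Y w).
Proof. by move=> mX mY i j; under eq_fun do rewrite mxE; exact: measurable_funD. Qed.

Lemma measurable_oppmx d (T : measurableType d) (R : realType) m n
    (X : T -> 'M[R]_(m, n)) :
  measurable_mx X -> measurable_mx (fun w => - X w).
Proof.
by move=> mX i j; under eq_fun do rewrite mxE; exact: measurableT_comp (mX i j).
Qed.

Lemma measurable_scalemx d (T : measurableType d) (R : realType) m n
    (a : T -> R) (X : T -> 'M[R]_(m, n)) :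
  measurable_fun [set: T] a -> measurable_mx X -> measurable_mx (fun w => a w *: X w).
Proof. by move=> ma mX i j; under eq_fun do rewrite mxE; exact: measurable_funM. Qed.

Lemma measurable_trmx d (T : measurableType d) (R : realType) m n
    (X : T -> 'M[R]_(m, n)) :
  measurable_mx X -> measurable_mx (fun w => (X w)^T).
Proof. by move=> mX i j; under eq_fun do rewrite mxE; exact: mX. Qed.

Lemma measurable_cstmx d (T : measurableType d) (R : realType) m n (A : 'M[R]_(m, n)) :
  measurable_mx (fun _ : T => A).
Proof. by move=> i j; exact: measurable_cst. Qed.

Lemma measurable_mxtrace d (T : measurableType d) (R : realType) n
    (X : T -> 'M[R]_n) :
  measurable_mx X -> measurable_fun [set: T] (fun w => \tr (X w)).
Proof. by move=> mX; apply: measurable_sum => i; exact: mX. Qed.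

Lemma measurable_det d (T : measurableType d) (R : realType) n
    (X : T -> 'M[R]_n) :
  measurable_mx X -> measurable_fun [set: T] (fun w => \det (X w)).
Proof.
move=> mX; apply: measurable_sum => s; apply: measurable_funM => //.
by apply: measurable_prod => i _; exact: mX.
Qed.

(** Through the adjugate formula, with the singular case, where [invmx] is the identity, separated
    by the measurable condition [\det = 0]. *)
Lemma measurable_invmx d (T : measurableType d) (R : realType) n
    (X : T -> 'M[R]_n) :
  measurable_mx X -> measurable_mx (fun w => invmx (X w)).
Proof.
move=> mX i j; rewrite /invmx.
have -> : (fun w => (if X w \in unitmx then (\det (X w))^-1 *: \adj (X w) else X w) i j) =
  (fun w => if \det (X w) == 0 then X w i j else (\det (X w))^-1 * \adj (X w) i j).
  by apply/funext => w; rewrite unitmxE unitfE; case: eqP; rewrite //= mxE.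
apply: measurable_fun_ifT; first by apply: measurable_fun_eqr => //; exact: measurable_det.
  exact: mX.
apply: measurable_funM; first by apply: measurable_inv; exact: measurable_det.
under eq_fun do rewrite mxE; apply: measurable_funM => //; apply: measurable_det => a b.
by under eq_fun do rewrite !mxE; exact: mX.
Qed.

Lemma measurable_dotv d (T : measurableType d) (R : realType) n
    (X Y : T -> 'cV[R]_n) :
  measurable_mx X -> measurable_mx Y ->
  measurable_fun [set: T] (fun w => dotv (X w) (Y w)).
Proof. by move=> mX mY; apply: measurable_mulmx => //; exact: measurable_trmx. Qed.

(* [F] is evaluated at grid points approximating [X]; these take countably many
   values, so no Borel structure on vectors is needed. *)
Lemma measurable_comp_continuous d (T : measurableType d) (R : realType) n
    (F : 'cV[R]_n -> R) (X : T -> 'cV[R]_n) :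
  continuous F -> measurable_mx X -> measurable_fun [set: T] (fun w => F (X w)).
Proof.
move=> cF mX.
pose Z N w : 'cV[int]_n := \col_i Num.floor (X w i 0 * N.+1%:R).
pose V N (z : 'cV[int]_n) : 'cV[R]_n := \col_i ((z i 0)%:~R / N.+1%:R).
apply: (@measurable_fun_cvg _ _ _ _ (fun N w => F (V N (Z N w)))) => [N _ B mB|w _].
  have -> : [set: T] `&` (fun w => F (V N (Z N w))) @^-1` B =
     \bigcup_z ((if `[< B (F (V N z)) >] then setT else set0) `&`
        \bigcap_(i in [set: 'I_n]) [set w | Num.floor (X w i 0 * N.+1%:R) = z i 0]).
    rewrite setTI; apply/seteqP; split => w /=.
      move=> Bw; exists (Z N w) => //; split; first by rewrite asboolT.
      by move=> i _ /=; rewrite mxE.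
    move=> [z _ [+ H]]; have -> : Z N w = z.
      by apply/matrixP => i j; rewrite ord1 mxE; exact: H.
    by case: asboolP.
  apply: countable_bigcupT_measurable => [|z]; first exact: countableP.
  apply: measurableI; first by case: asboolP.
  apply: fin_bigcap_measurable => [|i _]; first exact: finite_finset.
  have -> : [set w | Num.floor (X w i 0 * N.+1%:R) = z i 0] =
     [set: T] `&` (fun w => X w i 0 * N.+1%:R) @^-1` `[(z i 0)%:~R, (z i 0 + 1)%:~R[%classic.
    rewrite setTI; apply/seteqP; split => w /=; rewrite in_itv /=.
      by move=> <-; rewrite floor_itv.
    exact: floor_def.
  by apply: measurable_funM => //; exact: mX.
apply: (continuous_cvg _ (cF _)).
apply/cvgrPdist_le => e e0; near=> N.
have Ne : N.+1%:R^-1 <= e.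
  by near: N; have [M _ HM] := near_infty_natSinv_lt (PosNum e0); exists M => // N /HM /ltW.
rewrite [`| _ |]mx_normrE; apply/bigmax_leP; split; first exact: ltW.
move=> [i j] _ /=; rewrite ord1 !mxE; set x := X w i 0.
have N0 : 0 < N.+1%:R :> R by rewrite ltr0n.
have -> : x - (Num.floor (x * N.+1%:R))%:~R / N.+1%:R =
    (x * N.+1%:R - (Num.floor (x * N.+1%:R))%:~R) / N.+1%:R.
  by rewrite mulrBl mulfK ?gt_eqF.
have /andP[h1 h2] := floor_itv (x * N.+1%:R); rewrite intrD in h2.
rewrite ger0_norm; last by rewrite divr_ge0 ?subr_ge0.
by apply: le_trans Ne; rewrite ler_pdivrMr // mulVf ?gt_eqF //; lra.
Unshelve. all: by end_near. Qed.

(** Shaped like the events of [mutually_independent], so that independence evaluates the law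
    directly on these generators of the product sigma-algebra. *)
Definition cylinders (R : realType) (I : eqType) : set (set (I -> R)) :=
  [set A | exists s (B : I -> set R), [/\ uniq s, forall i, measurable (B i) &
     A = \bigcap_(i in [set` s]) (fun f => f i) @^-1` B i]].

Definition coord_space (R : realType) (I : eqType) := g_sigma_algebraType (@cylinders R I).

Lemma measurable_coord (R : realType) (I : eqType) (i : I) :
  measurable_fun [set: coord_space R I] (fun f => f i).
Proof.
move=> _ B mB; rewrite setTI; apply: sub_sigma_algebra.
exists [:: i], (fun=> B); split => //.
apply/seteqP; split => f /= h; first by move=> j; rewrite /= inE => /eqP ->.
by apply: (h i); rewrite /= inE.
Qed.

Lemma measurable_coords d (T : measurableType d) (R : realType) (I : eqType)
    (X : T -> coord_space R I) :
  (forall i, measurable_fun [set: T] (fun w => X w i)) -> measurable_fun [set: T] X.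
Proof.
move=> mX.
apply: (@measurability _ _ T (coord_space R I) setT X (@cylinders R I)) => //.
move=> _ [_ [s [B [us mB ->]]] <-].
rewrite setTI preimage_bigcap; apply: fin_bigcap_measurable => [|i _].
  exact: finite_seq.
by rewrite -[X in measurable X]setTI; exact: mX.
Qed.

Lemma cylinders_setI (R : realType) (I : eqType) : setI_closed (@cylinders R I).
Proof.
move=> _ _ [s1 [B1 [u1 m1 ->]]] [s2 [B2 [u2 m2 ->]]].
exists (undup (s1 ++ s2)), (fun i => (if i \in s1 then B1 i else setT) `&`
   (if i \in s2 then B2 i else setT)); split; first exact: undup_uniq.
  by move=> i; apply: measurableI; case: ifP.
apply/seteqP; split => f /=.
  move=> [h1 h2] i /=; rewrite mem_undup mem_cat => _.
  by split; case: ifP => // hi; [exact: h1|exact: h2].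
move=> h; split => i /= hi.
  by have := h i; rewrite /= mem_undup mem_cat hi => /(_ isT)[].
by have := h i; rewrite /= mem_undup mem_cat hi orbT => /(_ isT)[].
Qed.

(** The cylinders are stable under intersection and include the whole space, so finite measures
    agreeing on them agree everywhere. *)
Lemma coord_measure_unique (R : realType) (I : eqType)
    (m1 m2 : {measure set (coord_space R I) -> \bar R}) :
  (m1 setT < +oo)%E -> (forall A, @cylinders R I A -> m1 A = m2 A) ->
  forall A, measurable A -> m1 A = m2 A.
Proof.
move=> m1oo m12 A mA.
apply: (@g_sigma_algebra_measure_unique _ R (coord_space R I) (@cylinders R I) _ (fun=> setT)) => //.
- exact: sub_sigma_algebra.
- move=> _; exists [::], (fun=> setT); split => //.
  by apply/seteqP; split.
- by apply/seteqP; split => // f _; exists 0%N.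
- exact: cylinders_setI.
Qed.

(** * Laws of Gaussian families *)

Section NormalFamily.
Context (disp : measure_display) (T : measurableType disp) (R : realType)
  (P : probability T R) (I : eqType).

(** Independence and standard normality of all coordinates in one formula about a plain map, which
    can be checked for a transformed sample without rebuilding its coordinates as random
    variables. *)
Definition normal_family (X : T -> coord_space R I) : Prop :=
  (forall i, measurable_fun [set: T] (fun w => X w i)) /\
  forall s (B : I -> set R), uniq s -> (forall i, measurable (B i)) ->
    P (\bigcap_(i in [set` s]) (fun w => X w i) @^-1` B i) =
    (\prod_(i <- s) normal_prob (0 : R) (1 : R) (B i))%E.

Definition pack_mfun d' (S : measurableType d') (X : T -> S)
    (mX : measurable_fun [set: T] X) : {mfun T >-> S} :=
  HB.pack X (isMeasurableFun.Build _ _ _ _ X mX).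

Lemma normal_family_law (X X' : T -> coord_space R I) A :
  normal_family X -> normal_family X' -> measurable A ->
  P (X @^-1` A) = P (X' @^-1` A).
Proof.
move=> [mX hX] [mX' hX'] mA.
have MX := measurable_coords mX; have MX' := measurable_coords mX'.
apply: (@coord_measure_unique _ _ (distribution P (pack_mfun MX))
  (distribution P (pack_mfun MX'))) => //.
  by rewrite /= /distribution /pushforward preimage_setT probability_setT ltry.
move=> _ [s [B [us mB ->]]].
by rewrite /= /distribution /pushforward !preimage_bigcap; rewrite [LHS]hX // [RHS]hX'.
Qed.

Lemma normal_family_integral (X X' : T -> coord_space R I) (h : coord_space R I -> \bar R) :
  normal_family X -> normal_family X' -> measurable_fun setT h -> (forall f, (0 <= h f)%E) ->
  (\int[P]_w h (X w) = \int[P]_w h (X' w))%E.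
Proof.
move=> nX nX' mh h0; have MX := measurable_coords nX.1; have MX' := measurable_coords nX'.1.
have h0' : {in [set: coord_space R I], forall y, (0 <= h y)%E} by [].
have := ge0_integral_pushforward MX P measurableT mh h0'.
have := ge0_integral_pushforward MX' P measurableT mh h0'.
rewrite !preimage_setT => e1 e2; rewrite -[LHS]e2 -[RHS]e1.
by apply: eq_measure_integral => A mA _; exact: normal_family_law.
Qed.

End NormalFamily.

Lemma normal_probN (R : realType) (B : set R) : measurable B ->
  normal_prob (0 : R) (1 : R) (-%R @^-1` B) = normal_prob (0 : R) (1 : R) B.
Proof.
move=> mB; rewrite /normal_prob.
have mN : measurable_fun [set: R] (-%R : R -> R) by exact: oppr_measurable.
have mp : measurable_fun [set: R] (fun x : R => (normal_pdf 0 1 x)%:E).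
  by apply/measurable_EFinP; exact: measurable_normal_pdf.
have e x : normal_pdf (0 : R) 1 (- x) = normal_pdf 0 1 x.
  by rewrite /normal_pdf oner_eq0 /normal_fun !subr0 sqrrN.
transitivity (\int[pushforward lebesgue_measure (-%R : R -> measurableTypeR R)]_(x in B)
   (normal_pdf (0 : R) 1 x)%:E)%E.
  rewrite ge0_integral_pushforward //.
  - by apply: eq_integral => x _ /=; rewrite e.
  - exact: measurable_funS mp.
  - by move=> x _; rewrite lee_fin normal_pdf_ge0.
by apply: eq_measure_integral => A mA _; exact: lebesgue_measureN.
Qed.

Lemma normal_prob_set1 (R : realType) (a : R) : normal_prob (0 : R) (1 : R) [set a] = 0%E.
Proof.
have /null_content_dominatesP := @normal_prob_dominates R 0 1.
by apply => //; exact: lebesgue_measure_set1.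
Qed.

Section Invariance.
Context (disp : measure_display) (T : measurableType disp) (R : realType)
  (P : probability T R) (I : eqType).

Lemma measurable_sign_preimage (e : bool) (B : set R) : measurable B ->
  measurable ((fun x => (-1) ^+ e * x) @^-1` B).
Proof.
move=> mB; rewrite -[X in measurable X]setTI.
by apply: (measurable_funM (measurable_cst _) (@measurable_id _ R setT)).
Qed.

Lemma normal_family_sign_perm (X : T -> coord_space R I) (e : I -> bool) (p q : I -> I) :
  cancel p q -> cancel q p -> normal_family P X ->
  normal_family P (fun w i => (-1) ^+ e i * X w (p i)).
Proof.
move=> pq qp [mX hX]; split=> [i|s B us mB].
  by apply: measurable_funM => //; exact: mX.
pose B' j := (fun x => (-1) ^+ e (q j) * x) @^-1` B (q j).
have -> : \bigcap_(i in [set` s]) (fun w => (-1) ^+ e i * X w (p i)) @^-1` B i =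
   \bigcap_(j in [set` map p s]) (fun w => X w j) @^-1` B' j.
  apply/seteqP; split => w h j /=.
    by move=> /mapP[i si ->]; rewrite /B' /= pq; exact: h.
  by move=> si; have := h (p j); rewrite /B' /= pq; apply; exact: map_f.
rewrite hX; last by move=> j; exact: measurable_sign_preimage.
  rewrite big_map; apply: eq_bigr => i _; rewrite /B' pq; case: (e i).
    rewrite -[RHS]normal_probN //; congr (normal_prob _ _ _).
    by apply/seteqP; split => x /=; rewrite mulN1r.
  by congr (normal_prob _ _ _); apply/seteqP; split => x /=; rewrite mul1r.
by rewrite map_inj_uniq //; exact: can_inj pq.
Qed.

(** Stands for the family of all coordinates other than [i0], while remaining in the same space. *)
Definition zero_at (i0 : I) (f : coord_space R I) : coord_space R I :=
  fun i => if i == i0 then 0 else f i.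

Lemma measurable_zero_at (X : T -> coord_space R I) i0 :
  (forall i, measurable_fun [set: T] (fun w => X w i)) ->
  measurable_fun [set: T] (fun w => zero_at i0 (X w)).
Proof.
move=> mX; apply: measurable_coords => i; rewrite /zero_at.
by case: eqP => _; [exact: measurable_cst|exact: mX].
Qed.

(** For fixed [J] both sides are finite measures in [E]: the law of the other coordinates under [P]
    restricted to the event on [J], and a multiple of their law under [P]. It suffices to compare
    them on cylinders. *)
Lemma normal_family_indep (X : T -> coord_space R I) (i0 : I) (J : set R) E :
  normal_family P X -> measurable J -> measurable E ->
  P ((fun w => X w i0) @^-1` J `&` (fun w => zero_at i0 (X w)) @^-1` E) =
  (normal_prob (0 : R) (1 : R) J * P ((fun w => zero_at i0 (X w)) @^-1` E))%E.
Proof.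
move=> [mX hX] mJ mE; have mX0 := measurable_zero_at i0 mX.
have mD : measurable ((fun w => X w i0) @^-1` J).
  by rewrite -[X in measurable X]setTI; exact: mX.
have NJ : normal_prob (0 : R) (1 : R) J \is a fin_num.
  by apply: (@fin_num_measure _ _ _ (normal_prob (0 : R) (1 : R))).
have NJ0 : 0 <= fine (normal_prob (0 : R) (1 : R) J) by rewrite fine_ge0.
pose pf := (pushforward (mrestr P mD) (fun w => zero_at i0 (X w)) :
  {measure set (coord_space R I) -> \bar R}).
pose m1 := pf mX0.
pose m2 : {measure set (coord_space R I) -> \bar R} :=
  mscale (NngNum NJ0) (distribution P (pack_mfun mX0)).
have m1oo : (m1 setT < +oo)%E.
  rewrite /= /pushforward /mrestr preimage_setT setTI.
  by apply: le_lt_trans (probability_le1 _ mD) _; exact: ltry.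
rewrite setIC -[X in (X * _)%E](fineK NJ).
apply: (coord_measure_unique (m2 := m2) m1oo _ mE).
move=> _ [s [B [us mB ->]]].
have dE A : distribution P (pack_mfun mX0) A = P ((fun w => zero_at i0 (X w)) @^-1` A).
  by [].
rewrite /= /pushforward /mrestr /mscale /= fineK // dE !preimage_bigcap.
pose s' := [seq i <- s | i != i0].
have us' : uniq s' by rewrite filter_uniq.
have i0s' : i0 \notin s' by rewrite mem_filter eqxx.
have [h0|h0] := pselect (i0 \in s -> B i0 0); last first.
  have e0 : \bigcap_(i in [set` s])
      (fun w => zero_at i0 (X w)) @^-1` ((fun f => f i) @^-1` B i) = set0.
    apply/seteqP; split => // w h; apply: h0 => si.
    by have := h i0 si; rewrite /= /zero_at eqxx.
  by rewrite e0 set0I !measure0 mule0.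
have e1 : \bigcap_(i in [set` s]) (fun w => zero_at i0 (X w)) @^-1` ((fun f => f i) @^-1` B i) =
   \bigcap_(i in [set` s']) (fun w => X w i) @^-1` B i.
  apply/seteqP; split => w h i /=.
    rewrite mem_filter => /andP[ii0 si]; have := h i si.
    by rewrite /= /zero_at (negbTE ii0).
  move=> si; rewrite /zero_at; have [ii0|ii0] := eqVneq i i0.
    by rewrite ii0; apply: h0; rewrite -ii0.
  by apply: h; rewrite /= mem_filter ii0.
rewrite e1 [RHS](_ : _ = (\prod_(i <- i0 :: s') normal_prob (0 : R) (1 : R)
    (if i == i0 then J else B i)))%E; last first.
  rewrite big_cons eqxx hX //; congr (_ * _)%E; apply: eq_big_seq => i.
  by rewrite mem_filter => /andP[/negbTE ->].
rewrite -hX /= ?i0s' //; last by move=> i; case: ifP.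
congr (P _); apply/seteqP; split => w.
  move=> [h hJ] i /=; rewrite inE => /orP[/eqP ->|si]; first by rewrite eqxx.
  by rewrite ifN; [exact: h|apply: contraNneq i0s' => <-].
move=> h; split => [i /= si|].
  have := h i; rewrite /= inE si orbT => /(_ isT).
  by rewrite ifN //; apply: contraNneq i0s' => <-.
by have := h i0; rewrite /= inE eqxx; apply.
Qed.

End Invariance.

(** * Almost sure full rank *)

Lemma eq_measurable_funT d d' (T : measurableType d) (T' : measurableType d')
    (g f : T -> T') :
  f =1 g -> measurable_fun [set: T] g -> measurable_fun [set: T] f.
Proof. by move=> /funext ->. Qed.

(** [Y] sees only coordinates independent of [i0], so the pair has a product law. The diagonal has
    measure zero for it, each of its sections being a point and the normal law having no atoms. *)
Lemma coord_diag_negligible (disp : measure_display) (T : measurableType disp)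
    (R : realType) (P : probability T R) (I : eqType) (X : T -> coord_space R I) i0
    (Y : coord_space R I -> R) :
  normal_family P X -> measurable_fun setT Y ->
  P.-negligible [set w | X w i0 = Y (zero_at i0 (X w))].
Proof.
move=> nX mY; have [mX hX] := nX.
have mX0 := measurable_zero_at i0 mX.
pose Z w := Y (zero_at i0 (X w)).
have mZ : measurable_fun setT Z := measurableT_comp mY mX0.
have mZX : measurable_fun setT (fun w => (Z w, X w i0)) by exact: measurable_fun_pair.
pose m' := distribution P (pack_mfun mZX).
pose m1 := distribution P (pack_mfun mZ).
pose m2 := distribution P (pack_mfun (mX i0)).
have m2E B : measurable B -> m2 B = normal_prob (0 : R) (1 : R) B.
  move=> mB; have := hX [:: i0] (fun=> B) isT (fun=> mB).
  rewrite big_seq1 => <-; congr (P _); apply/seteqP; split => w /=.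
    by move=> h j; rewrite /= inE => /eqP ->.
  by apply; rewrite /= inE.
have prod (A B : set R) : measurable A -> measurable B ->
    m' (A `*` B) = (m1 A * m2 B)%E.
  move=> mA mB; rewrite m2E //.
  have mYA : measurable (Y @^-1` A) by rewrite -[X in measurable X]setTI; exact: mY.
  have := normal_family_indep i0 nX mB mYA; rewrite muleC => <-.
  rewrite setIC; congr (P _).
pose D := [set p : R * R | p.1 = p.2].
have mD : measurable D.
  rewrite -[D]setTI (_ : _ `&` _ = setT `&` (fun p : R * R => p.1 == p.2) @^-1` [set true]).
    by apply: measurable_fun_eqr.
  by rewrite !setTI; apply/seteqP; split => p /= /eqP.
exists (setT `&` (fun w => (Z w, X w i0)) @^-1` D); split.
- exact: (mZX measurableT _ mD).
- rewrite setTI -[LHS]/(m' D).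
  have H := @product_measure_unique _ _ _ _ R m1 m2 m' prod D mD.
  apply: etrans (esym H) _.
  rewrite /product_measure1 integral0_eq // => y _.
  have -> : (m2 \o xsection D) y = m2 [set y].
    congr (m2 _); rewrite xsectionE; apply/seteqP.
    by split => z; rewrite /D /= => ->.
  by rewrite m2E ?normal_prob_set1.
- by move=> w /= ->; split.
Qed.

(** Expansion along the last row makes the determinant affine in the corner entry, with coefficients
    [a] and [b] free of that entry. If it vanishes, either [a = 0], a smaller determinant covered by
    induction, or the entry equals [- b / a], a function of the other coordinates. *)
Lemma normal_family_det (disp : measure_display) (T : measurableType disp)
    (R : realType) (P : probability T R) (I : eqType) (X : T -> coord_space R I)
    m (c : 'I_m -> 'I_m -> I) :
  normal_family P X -> (forall i j i' j', c i j = c i' j' -> i = i' /\ j = j') ->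
  P.-negligible [set w | \det (\matrix_(i, j) X w (c i j)) = 0].
Proof.
move=> nX; elim: m c => [|m IH] c cI.
  rewrite (_ : [set w | _] = set0); first exact: negligible_set0.
  by apply/seteqP; split => // w /=; rewrite det_mx00 => /eqP; rewrite oner_eq0.
pose A (f : coord_space R I) : 'M[R]_m.+1 := \matrix_(i, j) f (c i j).
pose i0 := c ord_max ord_max.
pose a f := cofactor (A f) ord_max ord_max.
pose b f := \sum_(j | j != ord_max) A f ord_max j * cofactor (A f) ord_max j.
have detE f : \det (A f) = f i0 * a f + b f.
  by rewrite (expand_det_row _ ord_max) (bigD1 ord_max) //= {1}/A mxE.
have mA : measurable_mx A.
  move=> i j; apply: (eq_measurable_funT _ (measurable_coord (c i j))).
  by move=> f; rewrite mxE.
have mcof j : measurable_fun setT (fun f => cofactor (A f) ord_max j).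
  apply: measurable_funM; first exact: measurable_cst.
  apply: measurable_det => u v.
  apply: (eq_measurable_funT _ (measurable_coord (c (lift ord_max u) (lift j v)))).
  by move=> f; rewrite !mxE.
have mb : measurable_fun setT b.
  apply: (eq_measurable_funT (g := fun f => \sum_j (if j != ord_max then
      A f ord_max j * cofactor (A f) ord_max j else 0))).
    by move=> f; rewrite /b big_mkcond.
  apply: measurable_sum => j; case: (j != ord_max); last exact: measurable_cst.
  by apply: measurable_funM; [exact: mA|exact: mcof].
have zc f i j : (i != ord_max) || (j != ord_max) -> zero_at i0 f (c i j) = f (c i j).
  rewrite /zero_at; have [h|//] := eqVneq (c i j) i0.
  by have [-> ->] := cI _ _ _ _ h; rewrite eqxx.
have zcof f j : cofactor (A (zero_at i0 f)) ord_max j = cofactor (A f) ord_max j.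
  congr (_ * \det _); apply/matrixP => u v; rewrite !mxE.
  by rewrite zc // eq_sym neq_lift.
have zb f : b (zero_at i0 f) = b f.
  by apply: eq_bigr => j jm; rewrite zcof; congr (_ * _); rewrite !mxE zc // jm orbT.
have mY : measurable_fun setT (fun f => - b f / a f).
  apply: measurable_funM; first exact: measurableT_comp mb.
  by apply: measurable_inv; exact: mcof.
have n1 := coord_diag_negligible i0 nX mY.
have n2 : P.-negligible
    [set w | \det (\matrix_(i, j) X w (c (lift ord_max i) (lift ord_max j))) = 0].
  by apply: IH => i j i' j' h; have [/lift_inj -> /lift_inj ->] := cI _ _ _ _ h.
apply: (negligibleS _ (negligibleU n1 n2)) => w /=.
rewrite -/(A (X w)) detE => h.
have [a0|a0] := eqVneq (a (X w)) 0; [right|left].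
  move: a0; rewrite /a /cofactor -signr_odd addnn odd_double mul1r => <-.
  by congr (\det _); apply/matrixP => i j; rewrite !mxE.
rewrite zb [a (zero_at _ _)]zcof -/(a _).
by apply: (canRL (mulfK a0)); apply/eqP; rewrite -addr_eq0 h.
Qed.

Lemma full_col_rank_det (R : realType) d k (kd : (k <= d)%N) (U : 'M[R]_(d, k)) :
  \det (\matrix_(i, j) U (widen_ord kd i) j) != 0 -> full_col_rank U.
Proof.
move=> dU; apply: posdef_unit; split; first by rewrite trmx_mul trmxK.
move=> v v0; rewrite -mulmxA dotv_trmx trmxK lt_neqAle dotv_ge0 andbT eq_sym dotv_eq0.
apply: contra v0 => /eqP Uv.
have uU : \matrix_(i, j) U (widen_ord kd i) j \in unitmx by rewrite unitmxE unitfE.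
rewrite -(mulKmx uU v) (_ : _ *m v = 0) ?mulmx0 //.
apply/matrixP => i j; have := congr1 (fun B : 'cV[R]_d => B (widen_ord kd i) j) Uv.
by rewrite !mxE => h; rewrite -[RHS]h; apply: eq_bigr => l _; rewrite mxE.
Qed.

(** * Measurability of the iterates *)

Lemma continuous_gradient_coord (R : realType) d (f : 'cV[R]_d -> R) i :
  twice_differentiable f -> continuous (fun y => gradient f y i 0).
Proof.
move=> [_ dg] y; apply: differentiable_continuous.
exact: (differentiable_comp (dg y) (differentiable_coord _ _ _)).
Qed.

Lemma derive_cvg_seq (R : realType) d (F : 'cV[R]_d -> R) x v :
  differentiable F x ->
  (fun N : nat => N.+1%:R * (F (x + N.+1%:R^-1 *: v) - F x)) @ \oo --> 'D_v F x.
Proof.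
move=> dF; have dv := @diff_derivable _ _ _ _ _ v dF.
have -> : (fun N : nat => N.+1%:R * (F (x + N.+1%:R^-1 *: v) - F x)) =
   (fun h => h^-1 *: ((F \o shift x) (h *: v) - F x)) \o (fun N : nat => N.+1%:R^-1).
  by apply/funext => N /=; rewrite invrK [_ + x]addrC.
apply: (cvg_comp _ _ _ dv) => A /nbhs_ballP [e /= e0 HA].
have [M _ HM] := near_infty_natSinv_lt (PosNum e0).
exists M => // N /HM /= Ne; apply: HA; last by rewrite invr_eq0 pnatr_eq0.
by rewrite /ball /= sub0r normrN gtr0_norm // invr_gt0 ltr0n.
Qed.

Section MeasurableIterate.
Context (R : realType) (d k : nat) (f : 'cV[R]_d -> R) (tf : twice_differentiable f)
  (disp : measure_display) (S : measurableType disp).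

Lemma measurable_gradient (X : S -> 'cV[R]_d) :
  measurable_mx X -> measurable_mx (fun w => gradient f (X w)).
Proof.
move=> mX i j; rewrite ord1.
exact: (measurable_comp_continuous (continuous_gradient_coord (i := i) tf) mX).
Qed.

(** [twice_differentiable] provides no continuity of second derivatives, so the entries are reached
    as pointwise limits of difference quotients of the gradient along the steps [1 / (N + 1)]. *)
Lemma measurable_hessian (X : S -> 'cV[R]_d) :
  measurable_mx X -> measurable_mx (fun w => hessian f (X w)).
Proof.
move=> mX i j; pose v : 'cV[R]_d := delta_mx j 0.
apply: (@measurable_fun_cvg _ _ _ _ (fun N w => N.+1%:R *
   (gradient f (X w + N.+1%:R^-1 *: v) i 0 - gradient f (X w) i 0))) => [N|w _].
  apply: measurable_funM; first exact: measurable_cst.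
  apply: measurable_funB; last exact: measurable_gradient.
  apply: measurable_gradient; apply: measurable_addmx => //; exact: measurable_cstmx.
have dF : differentiable (fun y => gradient f y i 0) (X w).
  exact: (differentiable_comp (tf.2 (X w)) (differentiable_coord _ _ _)).
have -> : hessian f (X w) i j = 'D_v (fun y => gradient f y i 0) (X w) by rewrite [LHS]mxE.
exact (derive_cvg_seq (v := v) dF).
Qed.

Lemma measurable_hnorm (X V : S -> 'cV[R]_d) :
  measurable_mx X -> measurable_mx V -> measurable_fun setT (fun w => hnorm f (X w) (V w)).
Proof.
move=> mX mV; apply: measurable_sqrt; apply: measurable_dotv => //.
by apply: measurable_mulmx => //; exact: measurable_hessian.
Qed.

Lemma measurable_lambda (X : S -> 'cV[R]_d) :
  measurable_mx X -> measurable_fun setT (fun w => lambda f (X w)).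
Proof.
move=> mX; apply: measurable_sqrt; have mg := measurable_gradient mX.
apply: measurable_dotv => //; apply: measurable_mulmx => //.
by apply: measurable_invmx; exact: measurable_hessian.
Qed.

Lemma measurable_block_update rule (G A : S -> 'M[R]_d) (U : S -> 'M[R]_(d, k)) :
  measurable_mx G -> measurable_mx A -> measurable_mx U ->
  measurable_mx (fun w => block_update rule (G w) (A w) (U w)).
Proof.
move=> mG mA mU; have mUt := measurable_trmx mU.
have mGi : measurable_mx (fun w => invmx ((U w)^T *m G w *m U w)).
  by apply: measurable_invmx; do !apply: measurable_mulmx.
have mAi : measurable_mx (fun w => invmx ((U w)^T *m A w *m U w)).
  by apply: measurable_invmx; do !apply: measurable_mulmx.
case: rule; rewrite /= /block_bfgs /block_dfp.
  apply: measurable_addmx; last by do !apply: measurable_mulmx.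
  by apply: measurable_addmx => //; apply: measurable_oppmx; do !apply: measurable_mulmx.
apply: measurable_addmx; first by do !apply: measurable_mulmx.
apply: measurable_mulmx; first apply: measurable_mulmx => //.
  apply: measurable_addmx; first exact: measurable_cstmx.
  by apply: measurable_oppmx; do !apply: measurable_mulmx.
apply: measurable_addmx; first exact: measurable_cstmx.
by apply: measurable_oppmx; do !apply: measurable_mulmx.
Qed.

Lemma measurable_next_point (X : S -> 'cV[R]_d) (G : S -> 'M[R]_d) :
  measurable_mx X -> measurable_mx G -> measurable_mx (fun w => next_point f (X w) (G w)).
Proof.
move=> mX mG; apply: measurable_addmx => //; apply: measurable_oppmx.
by apply: measurable_mulmx; [exact: measurable_invmx|exact: measurable_gradient].
Qed.

Lemma measurable_iterate rule (M : R) x0 G0 (U : S -> nat -> 'M[R]_(d, k)) t :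
  (forall s, measurable_mx (fun w => U w s)) ->
  measurable_mx (fun w => (iterate rule f M x0 G0 (U w) t).1) /\
  measurable_mx (fun w => (iterate rule f M x0 G0 (U w) t).2).
Proof.
move=> mU; elim: t => [|t [mX mG]]; first by split; exact: measurable_cstmx.
have E w : iterate rule f M x0 G0 (U w) t.+1 =
  let xG := iterate rule f M x0 G0 (U w) t in
  (next_point f xG.1 xG.2, block_update rule (next_scaled f M xG.1 xG.2)
    (hessian f (next_point f xG.1 xG.2)) (U w t)).
  by have := iterateS rule f M x0 G0 (U w) t; case: (iterate _ _ _ _ _ (U w) t).
have mN := measurable_next_point mX mG.
split.
  rewrite (_ : (fun w => _) = (fun w => next_point f (iterate rule f M x0 G0 (U w) t).1
     (iterate rule f M x0 G0 (U w) t).2)) //.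
  by apply/funext => w; rewrite E.
rewrite (_ : (fun w => _) = (fun w => block_update rule
   (next_scaled f M (iterate rule f M x0 G0 (U w) t).1 (iterate rule f M x0 G0 (U w) t).2)
   (hessian f (next_point f (iterate rule f M x0 G0 (U w) t).1
     (iterate rule f M x0 G0 (U w) t).2)) (U w t))); last first.
  by apply/funext => w; rewrite E.
apply: measurable_block_update => //; last exact: measurable_hessian.
apply: measurable_scalemx => //; apply: measurable_funD; first exact: measurable_cst.
apply: measurable_funM; first exact: measurable_cst.
apply: measurable_hnorm => //.
by apply: measurable_addmx => //; exact: measurable_oppmx.
Qed.

Lemma measurable_potential (M : R) (X : S -> 'cV[R]_d) (G : S -> 'M[R]_d) :
  measurable_mx X -> measurable_mx G -> measurable_fun setT (fun w => potential f M (X w) (G w)).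
Proof.
move=> mX mG; have mH := measurable_hessian mX.
apply: measurable_funD.
  apply: measurable_mxtrace; apply: measurable_mulmx; first exact: measurable_invmx.
  by apply: measurable_addmx => //; exact: measurable_oppmx.
apply: measurable_funM; first exact: measurable_cst.
apply: measurable_funM; first exact: measurable_cst.
exact: measurable_lambda.
Qed.

End MeasurableIterate.

(** * Expectation of the potential *)

Lemma eq_iterate rule (R : realType) d k (f : 'cV[R]_d -> R) M x0 G0
    (U V : nat -> 'M[R]_(d, k)) t :
  (forall s, (s < t)%N -> U s = V s) ->
  iterate rule f M x0 G0 U t = iterate rule f M x0 G0 V t.
Proof.
elim: t => [//|t IH] UV /=; rewrite IH; last by move=> s st; apply: UV; rewrite ltnS ltnW.
by rewrite UV.
Qed.

Section Expectation.
Context (R : realType) (d k : nat) (f : 'cV[R]_d -> R) (L mu M b0 y0 : R)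
  (x0 : 'cV[R]_d) (G0 : 'M[R]_d) (rule : update_rule).
Hypotheses (d_gt0 : (0 < d)%N) (tf : twice_differentiable f) (M0 : 0 <= M)
  (hM : strongly_self_concordant M f) (pH : forall y, posdef (hessian f y))
  (mu0 : 0 < mu) (L0 : 0 < L)
  (HL : forall z, loewner_le (hessian f z) L%:M)
  (Hmu : forall z, loewner_le mu%:M (hessian f z))
  (env0 : envelope_ok b0 y0) (ok0 : state_ok f M b0 y0 x0 G0).
Let rho := 1 - k%:R / (d%:R * (L / mu)).
Hypothesis (rho0 : 0 < rho).

Let I := (nat * 'I_d * 'I_k)%type.
Let S := coord_space R I.

Definition sample_dir (w : S) (t : nat) : 'M[R]_(d, k) := \matrix_(i, j) w (t, i, j).

Let it (w : S) t := iterate rule f M x0 G0 (sample_dir w) t.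
Let b t := (envelope b0 y0 t).1.
Let y t := (envelope b0 y0 t).2.
Let g t := 1 + (1 + b t / 2) * (2 * b t) * (1 + d%:R / rho).

Definition all_full t (w : S) : bool := [forall s : 'I_t, full_col_rank (sample_dir w s)].

Lemma all_fullS t w : all_full t.+1 w = all_full t w && full_col_rank (sample_dir w t).
Proof.
apply/forallP/andP => [h|[/forallP h ht] s].
  split; last exact: (h ord_max).
  by apply/forallP => s; exact: (h (widen_ord (leqnSn t) s)).
have [st|] := ltnP s t; first exact: (h (Ordinal st)).
by move=> ts; rewrite (_ : s = t :> nat) //; apply/eqP; rewrite eqn_leq ts -ltnS ltn_ord.
Qed.

Lemma state_ok_iterate t w : all_full t w -> state_ok f M (b t) (y t) (it w t).1 (it w t).2.
Proof.
elim: t => [//|t IH]; rewrite all_fullS => /andP[/IH ok fU].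
have [env _] := envelopeP t env0.
have := state_ok_step rule tf M0 hM pH env ok fU.
rewrite /b /y /it /=; case: (envelope b0 y0 t) => bt yt /=.
by case: (iterate _ _ _ _ _ _ t).
Qed.

(* The potential is only controlled when the directions have full rank. *)
Definition full_potential t (w : S) : R :=
  if all_full t w then potential f M (it w t).1 (it w t).2 else 0.

Lemma full_potential_ge0 t w : 0 <= full_potential t w.
Proof.
rewrite /full_potential; case: ifP => // /state_ok_iterate[sG AG _ _].
by rewrite addr_ge0 ?sigma_ge0 // !mulr_ge0 // lambda_ge0.
Qed.

Lemma measurable_sample_dir t : measurable_mx (fun w : S => sample_dir w t).
Proof.
move=> i j; apply: (eq_measurable_funT _ (measurable_coord ((t, i, j) : I))).
by move=> w; rewrite mxE.
Qed.

Lemma measurable_all_full t : measurable_fun [set: S] (all_full t).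
Proof.
elim: t => [|t IH].
  apply: (eq_measurable_funT (g := fun=> true)); last exact: measurable_cst.
  by move=> w; apply/forallP => -[].
apply: (eq_measurable_funT (g := fun w => all_full t w && full_col_rank (sample_dir w t))).
  by move=> w; rewrite all_fullS.
apply: measurable_and => //.
apply: (eq_measurable_funT (g := fun w =>
    ~~ (\det ((sample_dir w t)^T *m sample_dir w t) == 0))).
  by move=> w; rewrite /full_col_rank unitmxE unitfE.
have mU := measurable_sample_dir t.
apply: measurable_neg; apply: measurable_fun_eqr; last exact: measurable_cst.
by apply: measurable_det; apply: measurable_mulmx => //; exact: measurable_trmx.
Qed.

Lemma measurable_full_potential t : measurable_fun [set: S] (full_potential t).
Proof.
apply: measurable_fun_ifT; [exact: measurable_all_full| |exact: measurable_cst].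
have [mX mG] := measurable_iterate tf rule M x0 G0 t measurable_sample_dir.
exact: measurable_potential.
Qed.

(** Together with [act_index], this writes the action on block [t] as signs times a reindexing of
    the whole sample, the form in which the Gaussian law is known to be invariant. *)
Definition act_sign (h : signed_perm d) t (a : I) : bool := (a.1.1 == t) && h.2 a.1.2.
Definition act_index (s : {perm 'I_d}) t (a : I) : I :=
  if a.1.1 == t then (a.1.1, s a.1.2, a.2) else a.
Definition act_sample (h : signed_perm d) t (w : S) : S :=
  fun a => (-1) ^+ act_sign h t a * w (act_index h.1 t a).

Lemma act_indexK s t : cancel (act_index s t) (act_index s^-1%g t).
Proof.
move=> [[t' i] j]; rewrite /act_index /=; case: (eqVneq t' t) => /= [->|/negbTE ->//].
by rewrite eqxx permK.
Qed.

Lemma sample_dir_act h t w s :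
  sample_dir (act_sample h t w) s =
  if s == t then sperm_act h (sample_dir w t) else sample_dir w s.
Proof.
apply/matrixP => i j; rewrite !mxE /act_sample /act_sign /act_index /=.
by case: eqVneq => [->|_] /=; rewrite !mxE ?expr0 ?mul1r.
Qed.

(** Takes the place of a conditional expectation given the past: the state at time [t] depends only
    on directions before [t], so it is constant along the orbit while the direction [t] runs through
    its signed permutations. *)
Lemma sum_full_potential t w :
  \sum_(h : signed_perm d) full_potential t.+1 (act_sample h t w) <=
  #|{: signed_perm d}|%:R * (rho * g t * full_potential t w).
Proof.
have dirE h s : (s < t)%N -> sample_dir (act_sample h t w) s = sample_dir w s.
  by move=> st; rewrite sample_dir_act ltn_eqF.
have dirt h : sample_dir (act_sample h t w) t = sperm_act h (sample_dir w t).
  by rewrite sample_dir_act eqxx.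
have afE h : all_full t (act_sample h t w) = all_full t w.
  by apply: eq_forallb => s; rewrite dirE.
(* Rank is constant along the orbit, so a rank deficient sample makes every term on the left
   zero. *)
have [/andP[af fU]|nf] := boolP (all_full t w && full_col_rank (sample_dir w t)); last first.
  rewrite big1 => [|h _].
    rewrite !mulr_ge0 ?ler0n ?full_potential_ge0 //; first exact: ltW.
    have [[bt0 _ _] _] := envelopeP t env0; rewrite -/(b t) in bt0.
    by rewrite addr_ge0 // !mulr_ge0 // addr_ge0 // divr_ge0 // ltW.
  by rewrite /full_potential all_fullS afE dirt full_col_rank_sperm (negbTE nf).
have ok := state_ok_iterate af; have [env _] := envelopeP t env0.
have := sum_potential_step rule tf M0 hM pH env ok d_gt0 mu0 L0 HL Hmu rho0 fU.
rewrite /full_potential af /it -/rho => H; apply: le_trans H.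
rewrite le_eqVlt; apply/orP; left; apply/eqP; apply: eq_bigr => h _.
rewrite all_fullS afE af dirt full_col_rank_sperm fU /= -/(it w t).
rewrite (eq_iterate _ _ _ _ _ (dirE h)) dirt -/(it w t).
by case: (it w t).
Qed.

Lemma ratio_le_full_potential t w : all_full t w ->
  lambda_ratio rule f M x0 G0 (sample_dir w) t <= (1 + b t / 2) * full_potential t w.
Proof.
move=> af; have ok := state_ok_iterate af; have [env _] := envelopeP t env0.
have := next_ratio_le tf M0 hM pH env ok d_gt0.
rewrite /full_potential af /lambda_ratio /= -/(it w t).
by case: (it w t).
Qed.

Context (disp : measure_display) (T : measurableType disp) (P : probability T R)
  (X : T -> S).
Hypothesis (nX : normal_family P X).

Lemma integral_full_potential t :
  (\int[P]_w (full_potential t (X w))%:E <=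
   (rho ^+ t * \prod_(i < t) g i * potential f M x0 G0)%:E)%E.
Proof.
have mX := measurable_coords nX.1.
have mh s : measurable_fun [set: S] (fun w => (full_potential s w)%:E).
  by apply/measurable_EFinP; exact: measurable_full_potential.
elim: t => [|t IH].
  rewrite big_ord0 expr0 !mul1r.
  rewrite (_ : (fun w => _) = cst (potential f M x0 G0)%:E).
    by rewrite integral_cst //= probability_setT mule1.
  apply/funext => w; rewrite /full_potential /=.
  by rewrite ifT //; apply/forallP => -[].
pose n := #|{: signed_perm d}|.
have n0 : 0 < n%:R :> R by rewrite ltr0n; apply/card_gt0P; exists (1%g, [ffun=> false]).
have nXh h : normal_family P (fun w => act_sample h t (X w)).
  have qp : cancel (act_index h.1^-1%g t) (act_index h.1 t).
    by move=> a; rewrite -{1}(invgK h.1) act_indexK.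
  exact: (normal_family_sign_perm (act_sign h t) (act_indexK h.1 t) qp nX).
have mXh h := measurable_coords (nXh h).1.
have h0 s w : (0 <= (full_potential s w)%:E)%E by rewrite lee_fin full_potential_ge0.
have gt0 : 0 <= g t.
  have [[bt0 _ _] _] := envelopeP t env0; rewrite -/(b t) in bt0.
  by rewrite addr_ge0 // !mulr_ge0 // addr_ge0 // divr_ge0 // ltW.
(* Every transformed sample has the same law, so each term of the group sum has the same
   integral. *)
have E : (n%:R%:E * \int[P]_w (full_potential t.+1 (X w))%:E =
    \int[P]_w (\sum_(h : signed_perm d) (full_potential t.+1 (act_sample h t (X w)))%:E))%E.
  rewrite ge0_integral_sum //; last first.
    by move=> h; exact: (measurableT_comp (mh t.+1) (mXh h)).
  rewrite (eq_bigr (fun=> \int[P]_w (full_potential t.+1 (X w))%:E)%E).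
    by rewrite sumr_const mule_natl.
  by move=> h _; exact: (normal_family_integral (nXh h) nX (mh t.+1) (h0 _)).
rewrite -(@lee_pmul2l _ n%:R%:E) //= E.
apply: (@le_trans _ _ (\int[P]_w ((n%:R * (rho * g t))%:E * (full_potential t (X w))%:E))%E).
  apply: ge0_le_integral => //.
  - by move=> w _; apply: sume_ge0.
  - apply: emeasurable_sum => h; exact: (measurableT_comp (mh t.+1) (mXh h)).
  - apply: measurable_funeM; exact: (measurableT_comp (mh t) mX).
  - move=> w _; rewrite sumEFin -EFinM lee_fin -!mulrA.
    by have := sum_full_potential t (X w); rewrite -!mulrA.
rewrite ge0_integralZl_EFin //; last 2 first.
- exact: (measurableT_comp (mh t) mX).
- by rewrite !mulr_ge0 ?ler0n // ltW.
rewrite EFinM -muleA; apply: lee_wpmul2l; first by rewrite lee_fin ler0n.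
apply: le_trans (lee_wpmul2l _ IH) _; first by rewrite lee_fin mulr_ge0 // ltW.
rewrite -EFinM lee_fin big_ord_recr exprS /= le_eqVlt; apply/orP; left; apply/eqP; ring.
Qed.

End Expectation.

(** * Gaussian directions and the final estimate *)

Lemma gaussian_normal_family (R : realType) (disp : measure_display)
    (T : measurableType disp) (P : probability T R) (d k : nat)
    (U : nat -> 'I_d -> 'I_k -> {RV P >-> R}) :
  gaussian_directions U ->
  normal_family P
    ((fun w a => U a.1.1 a.1.2 a.2 w) : T -> coord_space R (nat * 'I_d * 'I_k)%type).
Proof.
move=> [sU iU]; split=> [a|s B us mB]; first exact: measurable_funPT.
rewrite [LHS](iU s B us mB); apply: eq_bigr => a _.
exact: (sU a.1.1 a.1.2 a.2 (B a) (mB a)).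
Qed.

Lemma not_all_full_negligible (R : realType) (disp : measure_display)
    (T : measurableType disp) (P : probability T R) (d k : nat)
    (X : T -> coord_space R (nat * 'I_d * 'I_k)%type) t :
  (k <= d)%N -> normal_family P X -> P.-negligible [set w | ~~ all_full t (X w)].
Proof.
move=> kd nX; pose c (s : nat) (i j : 'I_k) := (s, widen_ord kd i, j).
have H s : P.-negligible [set w | \det (\matrix_(i, j) X w (c s i j)) = 0].
  apply: normal_family_det nX _ => i j i' j' [e1 e2]; split => //.
  exact: val_inj.
apply: (negligibleS _ (negligible_bigcup H)) => w /=.
rewrite negb_forall => /existsP[s nf]; exists (val s) => //=.
apply/eqP; apply: contraNT nf => dn0; apply: (full_col_rank_det (kd := kd)).
apply: contra dn0 => /eqP h; apply/eqP; rewrite -[RHS]h.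
by congr (\det _); apply/matrixP => i j; rewrite !mxE.
Qed.

Lemma measurable_lambda_ratio rule (R : realType) d k (f : 'cV[R]_d -> R) (M : R) x0 G0 t :
  twice_differentiable f ->
  measurable_fun [set: coord_space R (nat * 'I_d * 'I_k)%type]
    (fun w => lambda_ratio rule f M x0 G0 (@sample_dir R d k w) t).
Proof.
move=> tf; have mU := @measurable_sample_dir R d k.
apply: measurable_funM.
  by apply: (measurable_lambda tf); exact: (measurable_iterate tf rule M x0 G0 t.+1 mU).1.
apply: measurable_inv.
by apply: (measurable_lambda tf); exact: (measurable_iterate tf rule M x0 G0 t mU).1.
Qed.

Theorem theorem5p5 (R : realType) (d k : nat) (f : 'cV[R]_d -> R)
  (L mu M eta0 : R) (x0 : 'cV[R]_d) (G0 : 'M[R]_d) (rule : update_rule)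
  (disp : measure_display) (T : measurableType disp) (P : probability T R)
  (U : nat -> 'I_d -> 'I_k -> {RV P >-> R})
  (hf : twice_differentiable f)
  (hL : smooth L f)
  (mu_gt0 : 0 < mu) (hmu : strongly_convex mu f)
  (M_ge0 : 0 <= M) (hM : strongly_self_concordant M f)
  (k_gt0 : (1 <= k)%N) (k_lt_d : (k < d)%N)
  (eta0_ge1 : 1 <= eta0)
  (G0_posdef : posdef G0)
  (hx0 : let kappa := L / mu in
    M * lambda f x0 <=
      ln 2 / 4 * ((d%:R * kappa - k%:R) / (eta0 * d%:R ^+ 2 * kappa)))
  (hG0l : loewner_le (hessian f x0) G0)
  (hG0r : loewner_le G0 (eta0 *: hessian f x0))
  (hU : gaussian_directions U) :
  let kappa := L / mu in
  forall t : nat,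
    ('E_P[fun w => lambda_ratio rule f M x0 G0 (direction U w) t]
      <= (2 * d%:R * eta0 * (1 - k%:R / (d%:R * kappa)) ^+ t)%:E)%E.
Proof.
move=> kappa t; rewrite /= -/kappa in hx0.
have d2 : (2 <= d)%N by exact: leq_ltn_trans k_gt0 k_lt_d.
have d_gt0 : (0 < d)%N by exact: ltnW.
have d0 : 0 < d%:R :> R by rewrite ltr0n.
have Hmu z : loewner_le mu%:M (hessian f z) by exact: hessian_ge (ltW mu_gt0) hmu hf.
have HL z : loewner_le (hessian f z) L%:M by exact: hessian_le hL hf.
have pH z : posdef (hessian f z).
  apply: (posdef_loewner _ (hessian_trmx z hf) (Hmu z)).
  by rewrite -scalemx1; exact: posdef_scale (posdef1 _ _).
have muL : mu <= L.
  have := le_trans (Hmu x0 (delta_mx (Ordinal d_gt0) 0)) (HL x0 _).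
  by rewrite !dotv_delta !mxE eqxx !mulr1n.
have L0 : 0 < L := lt_le_trans mu_gt0 muL.
have kap1 : 1 <= kappa by rewrite ler_pdivlMr // mul1r.
have kap0 : 0 < kappa by exact: lt_le_trans kap1.
pose rho := 1 - k%:R / (d%:R * kappa).
have rho01 : 0 < rho <= 1.
  have dk0 : 0 < d%:R * kappa by rewrite mulr_gt0.
  apply/andP; split; last by rewrite gerDl oppr_le0 divr_ge0 // ?ler0n // ltW.
  rewrite subr_gt0 ltr_pdivrMr // mul1r; apply: (@lt_le_trans _ _ d%:R).
    by rewrite ltr_nat.
  by rewrite ler_peMr // ltW.
have [rho0 rho1] := andP rho01.
have eta_gt0 : 0 < eta0 by exact: lt_le_trans eta0_ge1.
pose b0 := ln 2 / 4 * (rho / d%:R) / eta0.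
have env0 : envelope_ok b0 eta0^-1 by exact: (envelope_init d2 rho01 eta0_ge1).
have ok0 : state_ok f M b0 eta0^-1 x0 G0.
  split => //; [exact: G0_posdef.1|by rewrite invrK|].
  (* Since [d kappa - k = d kappa rho], the bound assumed at [x0] is exactly [b0]. *)
  apply: le_trans hx0 _; rewrite le_eqVlt; apply/orP; left; apply/eqP.
  by rewrite /b0 /rho; field; rewrite !gt_eqF.
have nX := gaussian_normal_family hU.
set X := (X in normal_family P X) in nX.
have mX := measurable_coords nX.1.
pose h w := full_potential f M x0 G0 rule t (X w).
have mh : measurable_fun setT h.
  exact: (measurableT_comp (measurable_full_potential M x0 G0 rule hf t) mX).
have h0 w : 0 <= h w by exact (full_potential_ge0 rule hf M_ge0 hM pH env0 ok0 t (X w)).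
have := envelopeP t env0; set b := (envelope _ _ t).1; move=> [[b_ge0 _ _] _].
have c0 : 0 <= 1 + b / 2 by rewrite addr_ge0 // divr_ge0.
have E : (\int[P]_w (h w)%:E <= _)%E :=
  integral_full_potential rule d_gt0 hf M_ge0 hM pH mu_gt0 L0 HL Hmu env0 ok0 rho0 nX t.
rewrite unlock.
apply: (@le_trans _ _ (\int[P]_w ((1 + b / 2)%:E * (h w)%:E))%E).
  (* The pointwise bound holds where all directions before [t] have full rank, hence almost
     everywhere. *)
  apply: ae_ge0_le_integral => //.
  - by move=> w _; rewrite lee_fin divr_ge0 // lambda_ge0.
  - apply/measurable_EFinP.
    exact: (measurableT_comp (measurable_lambda_ratio rule M x0 G0 t hf) mX).
  - by move=> w _; rewrite -EFinM lee_fin mulr_ge0.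
  - by apply: measurable_funeM; apply/measurable_EFinP.
  apply: (negligibleS _ (not_all_full_negligible t (ltnW k_lt_d) nX)) => w /=.
  apply: contra_notN => af _; rewrite -EFinM lee_fin.
  exact: (ratio_le_full_potential rule d_gt0 hf M_ge0 hM pH env0 ok0 af).
rewrite ge0_integralZl_EFin //; first last.
- by apply/measurable_EFinP.
- by move=> w _; rewrite lee_fin.
apply: le_trans (lee_wpmul2l _ E) _; first by rewrite lee_fin.
rewrite -EFinM lee_fin -/rho.
(* One factor more than the [t] steps produce: the last one, [g], absorbs the [1 + b / 2] lost in
   passing from the ratio to the potential. *)
have := envelope_growth t.+1 d2 rho01 eta0_ge1 (erefl b0).
rewrite big_ord_recr /= -/b; set p := \prod_(i < t) _; set g := 1 + _ => pg.
have p0 : 0 <= p.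
  apply: prodr_ge0 => i _; have [[bi _ _] _] := envelopeP i env0.
  by rewrite addr_ge0 // !mulr_ge0 // addr_ge0 // divr_ge0 // ltW.
have gb : 1 + b / 2 <= g.
  have q0 : 0 <= d%:R / rho by rewrite divr_ge0 // ltW.
  rewrite lerD2l; apply: (@le_trans _ _ ((1 + b / 2) * (2 * b))); first by nra.
  by rewrite ler_peMr ?mulr_ge0 // lerDl.
have V0 : 0 <= potential f M x0 G0.
  rewrite addr_ge0 //; last by rewrite !mulr_ge0 // lambda_ge0.
  by apply: sigma_ge0 => //; exact: G0_posdef.1.
have V1 : potential f M x0 G0 <= d%:R * eta0.
  have [_ _ _ u0] := ok0; have [_ _ b10] := env0.
  have s1 : sigma (hessian f x0) G0 <= d%:R * eta0 - d%:R.
    rewrite sigmaE // lerD2r mxtrace_mulC.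
    apply: le_trans (mxtrace_mul_loewner _ G0_posdef.1 _ hG0r) _.
    - exact: posdef_psd (posdef_inv (pH x0)).
    - by rewrite trmxZ (pH x0).1.
    by rewrite -scalemxAl linearZ /= mulmxV ?posdef_unit // mxtrace1 mulrC.
  (* Hence [2 d u <= d / 5], which fits into the [- d] left over in [s1]. *)
  have u1 : M * lambda f x0 <= 1 / 10.
    have : eta0^-1 <= 1 by rewrite invf_le1.
    by move: u0 b10; lra.
  rewrite /potential -mulrA.
  have : d%:R * (M * lambda f x0) <= d%:R * (1 / 10) by rewrite ler_pM2l.
  by move: s1; lra.
have r0 : 0 <= rho ^+ t by rewrite exprn_ge0 // ltW.
rewrite (_ : 2 * d%:R * eta0 * rho ^+ t = rho ^+ t * (2 * (d%:R * eta0))); last by ring.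
rewrite mulrCA -!mulrA ler_wpM2l // mulrA; apply: ler_pM => //; first exact: mulr_ge0.
by apply: le_trans pg; apply: ler_wpM2l.
Qed.
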